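(* Let $\theta\in\mathbb Z$, $0\le r_1<1<r_2\le\infty$, let $\alpha_+(t)=\sum_{k\ge 0}\alpha_k t^k$ be analytic in $|t|<r_2$ and $\beta_-(t)=\sum_{k\le -1}\beta_k t^k$ be analytic in $|t|>r_1$ (vanishing at $\infty$), and let $$a(t)=\begin{pmatrix}1&\beta_-(t)\\ \alpha_+(t)& t^\theta+\alpha_+(t)\beta_-(t)\end{pmatrix}.$$ For $N\in\mathbb N$ let $a_N(t)$ be the Laurent matrix polynomial obtained from $a(t)$ by replacing $\alpha_+$ by $\alpha_+^{(N)}(t)=\sum_{k=0}^N\alpha_kt^k$ and $\beta_-$ by $\beta_-^{(N)}(t)=\sum_{k=-N}^{-1}\beta_kt^k$. Suppose that for at least one $N$ and one admissible pair $(\zeta_1,\zeta_2)$ the following two conditions are fulfilled: 1. $a_N(t)$ admits a stable $P$-normalised factorisation $a_N(t)=a_-^{(N)}(t)d_r(t)a_+^{(N)}(t)$ for some $P\in\{I_2,J_2\}$; 2. $q_N(\zeta_1,\zeta_2)<1$, where $$q_N(\zeta_1,\zeta_2)=\sigma\,\delta_N(\zeta_1,\zeta_2)\,\bigl\|\bigl(a_+^{(N)}\bigr)^{-1}\bigr\|_W\,\bigl\|\bigl(a_-^{(N)}\bigr)^{-1}\bigr\|_W .$$ Then $a(t)$ admits a stable factorisation with the same set of partial indices as $a_N(t)$.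
   Context: Wiener algebra. $W^{p\times p}$ is the algebra of $p\times p$ matrix functions $A(t)=\sum_{k\in\mathbb Z}A_kt^k$ on the unit circle $\mathbb T$ with $\|A\|_W=\sum_k\|A_k\|_1<\infty$, where $\|\cdot\|_1$ is the maximum column sum matrix norm. $W_+^{p\times p}$ (resp. $W_-^{p\times p}$) is the subalgebra of those with $A_k=0$ for $k<0$ (resp. $k>0$). Factorisation. A (right Wiener–Hopf) factorisation of an invertible $a\in W^{2\times2}$ is $a(t)=a_-(t)d_r(t)a_+(t)$, $t\in\mathbb T$, where $a_\pm\in W_\pm^{2\times2}$ is invertible in $W_\pm^{2\times 2}$ and $d_r(t)=\mathrm{diag}[t^{\rho_1},t^{\rho_2}]$ with integers $\rho_1\le\rho_2$ (the right partial indices, uniquely determined by $a$). The factorisation is stable if $\rho_2-\rho_1\le 1$. For the matrix functions $a$ and $a_N$ here the determinant is $t^\theta$, so $\rho_1+\rho_2=\theta$, and stability means: $\rho_1=\rho_2=\nu$ if $\theta=2\nu$; $\rho_1=\nu,\ \rho_2=\nu+1$ if $\theta=2\nu+1$. $P$-normalisation of a stable factorisation. Let $J_2=\begin{pmatrix}0&1\\1&0\end{pmatrix}$. If $\rho_1=\rho_2$, normalised means $a_-(\infty)=I_2$. If $\rho_2=\rho_1+1$, write $a_-(t)=C_0+C_1t^{-1}+\cdots$; the factorisation is $I_2$-normalised if $C_0$ is lower triangular with unit diagonal and $(C_1)_{12}=0$; it is $J_2$-normalised if $J_2C_0$ is lower triangular with unit diagonal and $(J_2C_1)_{12}=0$.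 A $P$-normalised factorisation, when it exists, is unique. Admissible pairs and $\delta_N$. A pair $(\zeta_1,\zeta_2)$ is admissible if $r_1<\zeta_1<1$ and $1<\zeta_2<r_2$; in addition $\zeta_1=r_1$ is allowed if $r_1>0$ and $\beta_-$ extends continuously to $|t|=r_1$, and $\zeta_2=r_2$ is allowed if $r_2<\infty$ and $\alpha_+$ extends continuously to $|t|=r_2$. Put $M_+(\zeta_2)=\max_{|t|=\zeta_2}|\alpha_+(t)|$, $M_-(\zeta_1)=\max_{|t|=\zeta_1}|\beta_-(t)|$ and $$\delta_N(\zeta_1,\zeta_2)=\Bigl(1+\frac{\zeta_2M_+(\zeta_2)}{\zeta_2-1}\Bigr)\frac{\zeta_1^{N+1}M_-(\zeta_1)}{1-\zeta_1}+\Bigl(1+\frac{\zeta_1M_-(\zeta_1)}{1-\zeta_1}\Bigr)\frac{M_+(\zeta_2)}{\zeta_2^N(\zeta_2-1)}.$$ Constant $\sigma$: $\sigma=\|d_r\|_W=\|d_r^{-1}\|_W$, i.e. $\sigma=1$ if $\theta$ is even and $\sigma=2$ if $\theta$ is odd. *)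

(* Defs.v *)
From HB Require Import structures.
From mathcomp Require Import all_boot all_order all_algebra.
From mathcomp Require Import complex.
From mathcomp Require Import all_classical all_reals all_analysis.
Set Implicit Arguments.
Unset Strict Implicit.
Unset Printing Implicit Defensive.
Import Order.TTheory GRing.Theory Num.Theory.
Import numFieldNormedType.Exports.
Local Open Scope classical_set_scope.
Local Open Scope ring_scope.
Local Open Scope complex_scope.

(* The complex plane is R[i]; its topology is the one carried
   by the alias R[i]^o, used only where limits are taken. *)

Definition cmod (R : realType) (z : R[i]) : R := complex.Re `|z|.

(* Both halves of a two-sided series take the coefficients c_k, k : int, of the
   whole series: [plus_terms] only sees k >= 0, [minus_terms] only k <= -1. *)
Definition plus_terms (R : realType) (c : int -> R[i]) (t : R[i]) (k : nat) :
    R[i]^o := c k%:Z * t ^ k%:Z.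

Definition minus_terms (R : realType) (c : int -> R[i]) (t : R[i]) (k : nat) :
    R[i]^o := c (- k.+1%:Z) * t ^ (- k.+1%:Z).

Definition plus_fun (R : realType) (c : int -> R[i]) (t : R[i]) : R[i] :=
  limn (series (plus_terms c t)).

Definition minus_fun (R : realType) (c : int -> R[i]) (t : R[i]) : R[i] :=
  limn (series (minus_terms c t)).

Definition plus_trunc (R : realType) (N : nat) (c : int -> R[i]) (t : R[i]) :
  R[i] := \sum_(k < N.+1) c k%:Z * t ^ k%:Z.

Definition minus_trunc (R : realType) (N : nat) (c : int -> R[i]) (t : R[i]) :
  R[i] := \sum_(k < N) c (- k.+1%:Z) * t ^ (- k.+1%:Z).

Definition disc (R : realType) (r2 : \bar R) : set R[i] :=
  [set t | ((cmod t)%:E < r2)%E].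

Definition closed_disc (R : realType) (r2 : \bar R) : set R[i] :=
  [set t | ((cmod t)%:E <= r2)%E].

Definition exterior (R : realType) (r1 : R) : set R[i] := [set t | r1 < cmod t].

Definition closed_exterior (R : realType) (r1 : R) : set R[i] :=
  [set t | r1 <= cmod t].

(* c_0 + c_1 t + c_2 t^2 + ... is analytic in |t| < r2. *)
Definition analytic_plus (R : realType) (r2 : \bar R) (c : int -> R[i]) :=
  forall t, disc r2 t -> cvgn (series (plus_terms c t)).

(* c_{-1} t^{-1} + c_{-2} t^{-2} + ... is analytic in |t| > r1. *)
Definition analytic_minus (R : realType) (r1 : R) (c : int -> R[i]) :=
  forall t, exterior r1 t -> cvgn (series (minus_terms c t)).

Definition norm1 (R : realType) (p : nat) (A : 'M[R[i]]_p) : R :=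
  \big[Num.max/0]_(j < p) \sum_(i < p) cmod (A i j).

Definition coef_norm (R : realType) (p : nat) (c : int -> 'M[R[i]]_p) : \bar R :=
  (\esum_(k in [set: int]) (norm1 (c k))%:E)%E.

(* An element of the Wiener algebra is given by its coefficients; the matrix
   function on the unit circle which it represents is [weval]. *)
Record wiener (R : realType) (p : nat) := Wiener {
  wcoef : int -> 'M[R[i]]_p;
  wcoef_summable : (coef_norm wcoef < +oo)%E }.

Definition wnorm (R : realType) (p : nat) (A : wiener R p) : R :=
  fine (coef_norm (wcoef A)).

Definition weval (R : realType) (p : nat) (A : wiener R p) (t : R[i]) :
    'M[R[i]]_p :=
  \matrix_(i, j) (plus_fun (fun k => wcoef A k i j) t
                  + minus_fun (fun k => wcoef A k i j) t).

Definition wplus (R : realType) (p : nat) (A : wiener R p) :=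
  forall k : int, k < 0 -> wcoef A k = 0.

Definition wminus (R : realType) (p : nat) (A : wiener R p) :=
  forall k : int, 0 < k -> wcoef A k = 0.

(* Coefficients are determined by the function on the circle, hence so is the
   inverse B of A. *)
Definition winverse (R : realType) (p : nat) (A B : wiener R p) :=
  forall t, cmod t = 1 -> weval A t *m weval B t = 1%:M.

Definition mx2 (R : realType) (a b c d : R[i]) : 'M[R[i]]_2 :=
  \matrix_(i, j) (if i == 0 then if j == 0 then a else b
                  else if j == 0 then c else d).

Definition J2 (R : realType) : 'M[R[i]]_2 := mx2 0 1 1 0.

Definition dr (R : realType) (rho1 rho2 : int) (t : R[i]) : 'M[R[i]]_2 :=
  mx2 (t ^ rho1) 0 0 (t ^ rho2).

Definition dr_coef (R : realType) (rho1 rho2 k : int) : 'M[R[i]]_2 :=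
  mx2 (k == rho1)%:R 0 0 (k == rho2)%:R.

(* sigma = ||d_r||_W, computed in [sigmaE] below. *)
Definition sigma (R : realType) (rho1 rho2 : int) : R :=
  fine (coef_norm (@dr_coef R rho1 rho2)).

Lemma cmod_nat (R : realType) (b : bool) : cmod (b%:R : R[i]) = b%:R.
Proof. by rewrite /cmod; case: b; rewrite ?normr0 ?normr1. Qed.
Lemma norm1_dr (R : realType) (rho1 rho2 k : int) :
  norm1 (@dr_coef R rho1 rho2 k) = ((k == rho1) || (k == rho2))%:R.
Proof.
rewrite /norm1 !big_ord_recl !big_ord0 !mxE /=.
have c0 : cmod (0 : R[i]) = 0 by rewrite /cmod normr0.
rewrite c0 !cmod_nat !addr0 add0r.
case: (k == rho1); case: (k == rho2);
  rewrite /= ?maxxx ?(max_l ler01) ?(max_r ler01) ?maxxx ?(max_l ler01) //.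
Qed.
Lemma sigmaE (R : realType) (rho1 rho2 : int) :
  sigma R rho1 rho2 = if rho1 == rho2 then 1 else 2.
Proof.
rewrite /sigma /coef_norm.
under eq_esum do rewrite norm1_dr.
rewrite (_ : (\esum_(k in [set: int]) _)%E =
   (\esum_(k in [set rho1; rho2]) 1%:E)%E :> \bar R); last first.
  rewrite [RHS]esum_mkcond; apply: eq_esum => k _.
  rewrite in_setU !in_set1.
  by case: (_ || _).
have [->|ne] := eqVneq rho1 rho2; first by rewrite setUid esum_set1.
rewrite esum_fset; [|exact: finite_set2|by []].
by rewrite fsbigU0 ?fsbig_set1 //= => k [-> /= e]; move: ne; rewrite e eqxx.
Qed.

Definition wh_factorisation (R : realType) (a : R[i] -> 'M[R[i]]_2)
    (am : wiener R 2) (rho1 rho2 : int) (ap : wiener R 2) :=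
  [/\ wminus am /\ (exists2 bm, wminus bm & winverse am bm),
      wplus ap /\ (exists2 bp, wplus bp & winverse ap bp),
      rho1 <= rho2 &
      forall t, cmod t = 1 ->
        a t = weval am t *m dr rho1 rho2 t *m weval ap t].

Definition stable (rho1 rho2 : int) : Prop := rho2 - rho1 <= 1.

(* [is_trig_mx] is lower triangularity. *)
Definition unit_lower_trig (R : realType) (A : 'M[R[i]]_2) : Prop :=
  is_trig_mx A /\ forall i, A i i = 1.

Definition normalised (R : realType) (P : 'M[R[i]]_2) (rho1 rho2 : int)
    (am : wiener R 2) :=
  (rho1 = rho2 -> wcoef am 0 = 1%:M) /\
  (rho2 = rho1 + 1 ->
     unit_lower_trig (P *m wcoef am 0) /\ (P *m wcoef am (-1)) 0 1 = 0).

Definition matrix_a (R : realType) (theta : int) (f g : R[i] -> R[i])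
    (t : R[i]) : 'M[R[i]]_2 :=
  mx2 1 (g t) (f t) (t ^ theta + f t * g t).

Definition extends_continuously (R : realType) (f : R[i] -> R[i])
    (D K : set R[i]) :=
  exists g : R[i]^o -> R[i]^o,
    {within (K : set R[i]^o), continuous g} /\ forall t, D t -> g t = f t.

(* The value at t of the continuous extension of f from D, if there is one. *)
Definition extension (R : realType) (f : R[i] -> R[i]) (D : set R[i])
    (t : R[i]) : R[i] :=
  if t \in D then f t
  else lim ((f s : R[i]^o) @[s --> within D (nbhs (t : R[i]^o))]).

Definition circle_max (R : realType) (f : R[i] -> R[i]) (zeta : R) : R :=
  sup [set cmod (f t) | t in [set t | cmod t = zeta]].

Definition Mplus (R : realType) (r2 : \bar R) (alpha : int -> R[i]) : R -> R :=
  circle_max (extension (plus_fun alpha) (disc r2)).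

Definition Mminus (R : realType) (r1 : R) (beta : int -> R[i]) : R -> R :=
  circle_max (extension (minus_fun beta) (exterior r1)).

Definition admissible (R : realType) (r1 : R) (r2 : \bar R)
    (alpha beta : int -> R[i]) (zeta1 zeta2 : R) :=
  (r1 < zeta1 < 1 \/
   [/\ zeta1 = r1, 0 < r1 &
       extends_continuously (minus_fun beta) (exterior r1) (closed_exterior r1)])
  /\
  ((1 < zeta2 /\ (zeta2%:E < r2)%E) \/
   zeta2%:E = r2 /\
   extends_continuously (plus_fun alpha) (disc r2) (closed_disc r2)).

Definition delta (R : realType) (r1 : R) (r2 : \bar R)
    (alpha beta : int -> R[i]) (N : nat) (zeta1 zeta2 : R) : R :=
  let Mp := Mplus r2 alpha zeta2 in
  let Mm := Mminus r1 beta zeta1 in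
  (1 + zeta2 * Mp / (zeta2 - 1)) * (zeta1 ^+ N.+1 * Mm / (1 - zeta1))
  + (1 + zeta1 * Mm / (1 - zeta1)) * (Mp / (zeta2 ^+ N * (zeta2 - 1))).

(* Main.v *)
Require Import Defs.
From HB Require Import structures.
From mathcomp Require Import all_boot all_order all_algebra.
From mathcomp Require Import complex.
From mathcomp Require Import all_classical all_reals all_analysis.
From mathcomp Require Import cyclic separable cyclotomic.
From mathcomp Require Import ring lra zify.
Set Implicit Arguments.
Unset Strict Implicit.
Unset Printing Implicit Defensive.
Import Order.TTheory GRing.Theory Num.Theory.
Import numFieldNormedType.Exports.
Local Open Scope classical_set_scope.
Local Open Scope ring_scope.
Local Open Scope complex_scope.

(** Write [D] for [d_r] and [E] for [a - a_N]. The Cauchy estimates for the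
    coefficients of [alpha_+] and [beta_-] give [||E|| <= delta_N], so that
    [X = D^-1 (a_-^(N))^-1 E (a_+^(N))^-1] has norm less than 1 and
    [a = a_-^(N) D (1 + X) a_+^(N)].

    Since [||X|| < 1], the equations [Y + P_+(X Y) = 1] and [V + P_-(V X) = 1],
    where [P_+] and [P_-] keep the coefficients [k >= 0] and [k < 0], are solved
    by Neumann series. With [U = (1 + X) Y] and [T = V (1 + X)] one has
    [V U = T Y], where [V U - 1] has only coefficients [k < 0] and [T Y] only
    [k >= 0]; hence both products are 1 and [1 + X = U T]. Finally
    [D (1 + X) = (D U D^-1) D T], and stability makes [D U D^-1] an element of
    [W_-]: conjugation by [D] shifts the off-diagonal entries of [U], whose
    coefficients live in [k <= -1], by at most one. *)

(** Elements of the Wiener algebra are handled through their coefficient families, with Cauchy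
    products as multiplication. Averaging over roots of unity takes the place of the contour
    integral: it shows that the coefficients are determined by the function on the circle, and it
    yields the Cauchy estimates. Ring laws in the algebra thus reduce to identities between complex
    numbers at each point of the circle.

    The algebra is commutative, so a one-sided inverse of a square matrix over it is two-sided. This
    makes [Y] and [V] genuine inverses of [T] and [U], and turns [U = (1 + X) Y] into [1 + X = U T].

    Matrices are measured by column sums of the norms of their entries. This norm is
    submultiplicative, is dominated by the norm of [W], and gives [D^-1] norm at most 1.

    When [zeta] is a boundary radius, the Cauchy estimates are proved on nearby circles inside the
    domain, where the coefficients are summable, and carried to the boundary by compactness of the
    circle. *)

Section Modulus.
Variable R : realType.
Implicit Types x y z : R[i].

Lemma cmodE z : (cmod z)%:C = `|z|.
Proof. by rewrite /cmod RRe_real// ger0_real. Qed.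

Lemma cmod_ge0 z : 0 <= cmod z.
Proof. by rewrite -ler0c cmodE. Qed.

Lemma cmod0 : cmod (0 : R[i]) = 0.
Proof. by rewrite /cmod normr0. Qed.

Lemma cmod1 : cmod (1 : R[i]) = 1.
Proof. by rewrite /cmod normr1. Qed.

Lemma cmodM x y : cmod (x * y) = cmod x * cmod y.
Proof. by apply: complexI; rewrite rmorphM/= !cmodE normrM. Qed.

Lemma cmodD x y : cmod (x + y) <= cmod x + cmod y.
Proof. by rewrite -lecR rmorphD/= !cmodE ler_normD. Qed.

Lemma cmodN x : cmod (- x) = cmod x.
Proof. by rewrite /cmod normrN. Qed.

Lemma cmodB x y : cmod (x - y) = cmod (y - x).
Proof. by rewrite -cmodN opprB. Qed.

Lemma cmod_eq0 x : (cmod x == 0) = (x == 0).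
Proof. by rewrite -(inj_eq (@complexI R)) cmodE normr_eq0. Qed.

Lemma cmodXz x (k : int) : cmod (x ^ k) = cmod x ^ k.
Proof.
case: k => n; first by apply: complexI; rewrite cmodE normrX -cmodE rmorphXn.
by apply: complexI; rewrite cmodE /exprz normfV normrX -cmodE fmorphV rmorphXn.
Qed.

Lemma cmodV x : cmod x^-1 = (cmod x)^-1.
Proof. by have := cmodXz x (-1); rewrite !exprN1. Qed.

Lemma cmod_real (r : R) : cmod r%:C = `|r|.
Proof.
by rewrite /cmod normc_def /= expr0n addr0 sqrtr_sqr.
Qed.

Lemma cmod_sum (I : Type) (s : seq I) (P : pred I) (F : I -> R[i]) :
  cmod (\sum_(i <- s | P i) F i) <= \sum_(i <- s | P i) cmod (F i).
Proof.
elim/big_rec2: _ => [|i u v _ h]; first by rewrite cmod0.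
by rewrite (le_trans (cmodD _ _))// lerD2l.
Qed.

Lemma Re_le_cmod z : `|complex.Re z| <= cmod z.
Proof. by rewrite -lecR cmodE normc_ge_Re. Qed.

Lemma Im_le_cmod z : `|complex.Im z| <= cmod z.
Proof.
have := Re_le_cmod (z * 'i%C); rewrite ReiNIm normrN cmodM.
by rewrite [cmod 'i%C]/cmod normc_def/= expr0n expr1n add0r sqrtr1 mulr1.
Qed.

Lemma cmod_le_ReIm z : cmod z <= `|complex.Re z| + `|complex.Im z|.
Proof.
rewrite {1}(complexE z) (le_trans (cmodD _ _))// cmodM !cmod_real.
by rewrite [cmod 'i%C]/cmod normc_def/= expr0n expr1n add0r sqrtr1 mul1r.
Qed.

End Modulus.

(** * Unordered sums of nonnegative families *)

Section NonnegativeSums.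
Variable R : realType.

Definition nfin (T : choiceType) (f : T -> R) :=
  (\esum_(i in [set: T]) (f i)%:E < +oo)%E.

(** [fine] sends an infinite sum to 0, so [nsum] is meaningful only together with [nfin]; estimates
    that must also yield finiteness are stated in the extended reals. *)
Definition nsum (T : choiceType) (f : T -> R) : R :=
  fine (\esum_(i in [set: T]) (f i)%:E)%E.

Variable T : choiceType.
Implicit Types f g : T -> R.

Lemma nsumE f : (forall i, 0 <= f i) -> nfin f ->
  (\esum_(i in [set: T]) (f i)%:E)%E = (nsum f)%:E.
Proof.
move=> f0 ff; rewrite /nsum fineK// ge0_fin_numE//.
by apply: esum_ge0 => i _; rewrite lee_fin.
Qed.

Lemma nsum_ge0 f : (forall i, 0 <= f i) -> 0 <= nsum f.
Proof. by move=> f0; apply/fine_ge0/esum_ge0 => i _; rewrite lee_fin. Qed.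

Lemma nfin_le f g : (forall i, f i <= g i) -> nfin g -> nfin f.
Proof. by move=> fg; apply: le_lt_trans; apply: le_esum => i _; rewrite lee_fin. Qed.

Lemma nfin_bound f (M : R) :
  (\esum_(i in [set: T]) (f i)%:E <= M%:E)%E -> nfin f.
Proof. by move=> h; rewrite /nfin (le_lt_trans h)// ltry. Qed.

Lemma nsum_bound f (M : R) : (forall i, 0 <= f i) ->
  (\esum_(i in [set: T]) (f i)%:E <= M%:E)%E -> nsum f <= M.
Proof.
by move=> f0 h; rewrite -lee_fin -nsumE//; exact: nfin_bound h.
Qed.

Lemma le_nsum f g : (forall i, 0 <= f i) -> (forall i, f i <= g i) -> nfin g ->
  nsum f <= nsum g.
Proof.
move=> f0 fg gf; rewrite -lee_fin -!nsumE//.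
- by apply: le_esum => i _; rewrite lee_fin.
- by move=> i; rewrite (le_trans (f0 i)).
- exact: nfin_le gf.
Qed.

Lemma esumDr f g : (forall i, 0 <= f i) -> (forall i, 0 <= g i) ->
  (\esum_(i in [set: T]) (f i + g i)%:E =
   \esum_(i in [set: T]) (f i)%:E + \esum_(i in [set: T]) (g i)%:E)%E.
Proof.
move=> f0 g0; rewrite -esumD; first by apply: eq_esum => i _; rewrite EFinD.
- by move=> i _; rewrite lee_fin.
- by move=> i _; rewrite lee_fin.
Qed.

Lemma nfinD f g : (forall i, 0 <= f i) -> (forall i, 0 <= g i) ->
  nfin f -> nfin g -> nfin (fun i => f i + g i).
Proof. by move=> f0 g0 ff gf; rewrite /nfin esumDr// lte_add_pinfty. Qed.

Lemma nsumD f g : (forall i, 0 <= f i) -> (forall i, 0 <= g i) ->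
  nfin f -> nfin g -> nsum (fun i => f i + g i) = nsum f + nsum g.
Proof.
move=> f0 g0 ff gf; apply: EFin_inj; rewrite EFinD -!nsumE//.
- exact: esumDr.
- by move=> i; rewrite addr_ge0.
- exact: nfinD.
Qed.

Lemma esumZ_le (c : R) f : 0 <= c -> (forall i, 0 <= f i) -> nfin f ->
  (\esum_(i in [set: T]) (c * f i)%:E <= (c * nsum f)%:E)%E.
Proof.
move=> c0 f0 ff; apply: ge_ereal_sup => _ [A [finA _]] <-.
under eq_fsbigr do rewrite EFinM.
rewrite -ge0_mule_fsumr; last by move=> i; rewrite lee_fin.
rewrite EFinM lee_wpmul2l// -nsumE//.
by apply: ereal_sup_ubound; exists A.
Qed.

Lemma nfinZ (c : R) f : 0 <= c -> (forall i, 0 <= f i) -> nfin f ->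
  nfin (fun i => c * f i).
Proof. by move=> c0 f0 ff; exact: nfin_bound (esumZ_le c0 f0 ff). Qed.

(** The inequality missing from [esumZ_le] is [esumZ_le] itself, for [c^-1] and the family
    [c * f]. *)
Lemma nsumZ (c : R) f : 0 <= c -> (forall i, 0 <= f i) -> nfin f ->
  nsum (fun i => c * f i) = c * nsum f.
Proof.
move=> c0 f0 ff; apply/eqP; rewrite eq_le.
have cf0 i : 0 <= c * f i by rewrite mulr_ge0.
rewrite nsum_bound ?esumZ_le//=.
have [->|cn0] := eqVneq c 0; first by rewrite mul0r nsum_ge0// => i; rewrite mul0r.
have cp : 0 < c by rewrite lt0r cn0.
rewrite -ler_pdivlMl//; apply: (nsum_bound f0).
have := esumZ_le (_ : 0 <= c^-1) cf0 (nfinZ c0 f0 ff).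
rewrite invr_ge0 => /(_ c0); apply: le_trans.
by apply: le_esum => i _; rewrite mulKf.
Qed.

(** Covers shifts of [int], swaps of pairs and the two embeddings of [nat] in [int]. *)
Lemma esum_injP (U : choiceType) (e : U -> T) (f : T -> \bar R) : injective e ->
  (forall k, (forall i, k <> e i) -> f k = 0%E) ->
  (\esum_(k in [set: T]) f k = \esum_(i in [set: U]) f (e i))%E.
Proof.
move=> inje f0; rewrite -(@esum_image R U T setT e f); last first.
  by move=> i j _ _; exact: inje.
rewrite [RHS]esum_mkcond; apply: eq_esum => k _.
case: ifPn => // kn; apply: f0 => i ki; move: kn; rewrite ki => /negP; apply.
by rewrite inE; exists i.
Qed.

(** The sum is a supremum over finite sets, so some finite partial sum comes within [eps] of it.
    This approximates infinite sums by finite ones over [nat] and over [int] alike. *)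
Lemma nfin_tail f (eps : R) : (forall i, 0 <= f i) -> nfin f -> 0 < eps ->
  exists2 A : set T, finite_set A &
    (\esum_(i in [set: T]) (if i \in A then 0 else f i)%:E <= eps%:E)%E.
Proof.
move=> f0 ff e0; have fE := nsumE f0 ff.
have : ((nsum f - eps)%:E < \esum_(i in [set: T]) (f i)%:E)%E.
  by rewrite fE lte_fin ltrBlDr ltrDl.
move/ereal_sup_gt => [_ [A [finA _]] <-] hA; exists A => //.
pose p i := if i \in A then f i else 0; pose q i := if i \in A then 0 else f i.
have p0 i : 0 <= p i by rewrite /p; case: ifP.
have q0 i : 0 <= q i by rewrite /q; case: ifP.
have := esumDr p0 q0.
have -> : (fun i => (p i + q i)%:E) = (fun i => (f i)%:E).
  by apply/funext => i; rewrite /p /q; case: ifP; rewrite ?addr0 ?add0r.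
have -> : (\esum_(i in [set: T]) (p i)%:E = \sum_(i \in A) (f i)%:E)%E.
  rewrite -esum_fset//; last by move=> i _; rewrite lee_fin.
  by rewrite [RHS]esum_mkcond; apply: eq_esum => i _; rewrite /p; case: ifP.
rewrite fE; have : (0 <= \esum_(i in [set: T]) (q i)%:E)%E.
  by apply: esum_ge0 => i _; rewrite lee_fin.
move: hA; rewrite -/q; set x := (\esum_(i in _) _)%E; set y := (\sum_(i \in A) _)%E.
case: x => [x||]; case: y => [y||] //=.
by rewrite lte_fin !lee_fin => h _ [] h2; lra.
Qed.

End NonnegativeSums.

(** * Absolutely summable real families *)

Section SignedSums.
Variable R : realType.

Definition rsum (T : choiceType) (f : T -> R) : R :=
  nsum (fun i => Num.max (f i) 0) - nsum (fun i => Num.max (- f i) 0).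

Definition rsummable (T : choiceType) (f : T -> R) := nfin (fun i => `|f i|).

Lemma posp_ge0 (x : R) : 0 <= Num.max x 0.
Proof. by rewrite le_max lexx orbT. Qed.

Lemma posp_le (x : R) : Num.max x 0 <= `|x|.
Proof. by rewrite ge_max ler_norm normr_ge0. Qed.

Lemma negp_le (x : R) : Num.max (- x) 0 <= `|x|.
Proof. by rewrite -normrN posp_le. Qed.

Lemma posp_negp (x : R) : x = Num.max x 0 - Num.max (- x) 0.
Proof.
case/orP: (le_total 0 x) => x0.
  by rewrite max_l// max_r ?subr0// oppr_le0.
by rewrite max_r// max_l ?sub0r ?opprK// oppr_ge0.
Qed.

Lemma posp_fin (T : choiceType) (f : T -> R) :
  rsummable f -> nfin (fun i => Num.max (f i) 0).
Proof. by apply: nfin_le => i; exact: posp_le. Qed.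

Lemma negp_fin (T : choiceType) (f : T -> R) :
  rsummable f -> nfin (fun i => Num.max (- f i) 0).
Proof. by apply: nfin_le => i; exact: negp_le. Qed.

(* The sum may be computed from any decomposition into nonnegative summable
   parts; all the algebraic laws of [rsum] come from this. *)
Lemma rsum_diff (T : choiceType) (p q : T -> R) : (forall i, 0 <= p i) ->
  (forall i, 0 <= q i) -> nfin p -> nfin q ->
  rsum (fun i => p i - q i) = nsum p - nsum q.
Proof.
move=> p0 q0 pf qf; rewrite /rsum.
set a := fun i => Num.max (p i - q i) 0.
set b := fun i => Num.max (- (p i - q i)) 0.
have sf : rsummable (fun i => p i - q i).
  apply: nfin_le (nfinD p0 q0 pf qf) => i.
  by rewrite (le_trans (ler_normB _ _))// !ger0_norm.
have a0 i : 0 <= a i by exact: posp_ge0.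
have b0 i : 0 <= b i by exact: posp_ge0.
have af : nfin a by exact: posp_fin.
have bf : nfin b by exact: negp_fin.
apply/eqP; rewrite subr_eq addrAC eq_sym subr_eq -!nsumD//; apply/eqP.
congr nsum; apply/funext => i; have := posp_negp (p i - q i).
by rewrite -/(a i) -/(b i) => h; lra.
Qed.

Variable T : choiceType.
Implicit Types f g : T -> R.

Lemma rsummableZ (c : R) f : rsummable f -> rsummable (fun i => c * f i).
Proof.
move=> ff; apply: nfin_le (nfinZ (normr_ge0 c) _ ff) => // i; by rewrite normrM.
Qed.

Lemma rsum_nonneg f : (forall i, 0 <= f i) -> rsum f = nsum f.
Proof.
move=> f0; rewrite /rsum.
have -> : (fun i => Num.max (f i) 0) = f by apply/funext => i; rewrite max_l.
have -> : (fun i => Num.max (- f i) 0) = (fun=> 0).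
  by apply/funext => i; rewrite max_r// oppr_le0.
by rewrite [X in _ - X]/nsum esum1// subr0.
Qed.

Lemma rsumD f g : rsummable f -> rsummable g ->
  rsum (fun i => f i + g i) = rsum f + rsum g.
Proof.
move=> ff gf.
have -> : (fun i => f i + g i) = (fun i => (Num.max (f i) 0 + Num.max (g i) 0)
    - (Num.max (- f i) 0 + Num.max (- g i) 0)).
  apply/funext => i; have := posp_negp (f i); have := posp_negp (g i); lra.
have P i : 0 <= Num.max (f i) 0 by exact: posp_ge0.
have P' i : 0 <= Num.max (- f i) 0 by exact: posp_ge0.
have Q i : 0 <= Num.max (g i) 0 by exact: posp_ge0.
have Q' i : 0 <= Num.max (- g i) 0 by exact: posp_ge0.
have Pf := posp_fin ff; have Pf' := negp_fin ff.
have Qf := posp_fin gf; have Qf' := negp_fin gf.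
rewrite rsum_diff; first by rewrite /rsum !nsumD//; lra.
- by move=> i; rewrite addr_ge0.
- by move=> i; rewrite addr_ge0.
- exact: nfinD.
- exact: nfinD.
Qed.

Lemma rsumN f : rsum (fun i => - f i) = - rsum f.
Proof.
rewrite /rsum opprB; congr (_ - nsum _).
by apply/funext => i; rewrite opprK.
Qed.

Lemma rsumZ (c : R) f : rsummable f -> rsum (fun i => c * f i) = c * rsum f.
Proof.
move=> ff.
have h (d : R) : 0 <= d -> rsum (fun i => d * f i) = d * rsum f.
  move=> d0.
  have -> : (fun i => d * f i) =
            (fun i => d * Num.max (f i) 0 - d * Num.max (- f i) 0).
    by apply/funext => i; rewrite -mulrBr -posp_negp.
  have P i : 0 <= Num.max (f i) 0 by exact: posp_ge0.
  have P' i : 0 <= Num.max (- f i) 0 by exact: posp_ge0.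
  have Pf := posp_fin ff; have Pf' := negp_fin ff.
  rewrite rsum_diff; first by rewrite /rsum !nsumZ// mulrBr.
  - by move=> i; rewrite mulr_ge0.
  - by move=> i; rewrite mulr_ge0.
  - exact: nfinZ.
  - exact: nfinZ.
have [c0|c0] := leP 0 c; first exact: h.
rewrite -[RHS]opprK -mulNr -h ?oppr_ge0 ?ltW// -rsumN; congr rsum.
by apply/funext => i; rewrite mulNr opprK.
Qed.

Lemma rsum_le f g : rsummable f -> rsummable g -> (forall i, f i <= g i) ->
  rsum f <= rsum g.
Proof.
move=> ff gf fg; rewrite -subr_ge0 -rsumN -rsumD//; last first.
  by rewrite /rsummable; under eq_fun do rewrite normrN.
rewrite rsum_nonneg ?nsum_ge0// => i; by rewrite subr_ge0.
Qed.

Lemma rsum_inj (U : choiceType) (e : U -> T) f : injective e ->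
  (forall k, (forall i, k <> e i) -> f k = 0) ->
  rsum f = rsum (fun i => f (e i)).
Proof.
move=> inje f0; rewrite /rsum /nsum; congr (fine _ - fine _);
  by apply: esum_injP => // k /f0 ->; rewrite ?oppr0 maxxx.
Qed.

End SignedSums.

(** * Tonelli and Fubini for real families *)

Section DoubleSums.
Variables (R : realType) (T U : choiceType).

(** A row is the whole family with all other rows set to zero, hence bounded by the full sum. *)
Lemma nfin_row (F : T * U -> R) (i : T) : (forall k, 0 <= F k) -> nfin F ->
  nfin (fun j => F (i, j)).
Proof.
move=> F0; apply: le_lt_trans.
have inj : injective (fun j : U => (i, j)) by move=> j j' [].
have h := @esum_injP R (T * U)%type U (fun j => (i, j))
  (fun k => if k.1 == i then (F k)%:E else 0%E) inj.
rewrite (_ : (\esum_(j in _) _)%E =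
  \esum_(j in [set: U]) (if (i, j).1 == i then (F (i, j))%:E else 0%E)).
  rewrite -h; first by apply: le_esum => k _; case: ifP; rewrite ?lee_fin.
  by move=> [a b] ab /=; case: eqP => // ai; case: (ab b); rewrite ai.
by apply: eq_esum => j _ /=; rewrite eqxx.
Qed.

Lemma esum_pairs (F : T * U -> R) : (forall k, 0 <= F k) ->
  (\esum_(k in [set: T * U]) (F k)%:E =
   \esum_(i in [set: T]) \esum_(j in [set: U]) (F (i, j))%:E)%E.
Proof.
move=> F0; rewrite esum_esum; last by move=> *; rewrite lee_fin.
rewrite (_ : [set: T] `*`` _ = setT); last by apply/seteqP; split.
by apply: eq_esum => -[].
Qed.

Lemma esum_rows (F : T * U -> R) : (forall k, 0 <= F k) -> nfin F ->
  (\esum_(k in [set: T * U]) (F k)%:E =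
   \esum_(i in [set: T]) (nsum (fun j => F (i, j)))%:E)%E.
Proof.
move=> F0 Ff; rewrite esum_pairs//; apply: eq_esum => i _.
by rewrite nsumE//; exact: nfin_row.
Qed.

Lemma nfin_nsum (F : T * U -> R) : (forall k, 0 <= F k) -> nfin F ->
  nfin (fun i => nsum (fun j => F (i, j))).
Proof. by move=> F0 Ff; rewrite /nfin -esum_rows. Qed.

Lemma nsum_rows (F : T * U -> R) : (forall k, 0 <= F k) -> nfin F ->
  nsum F = nsum (fun i => nsum (fun j => F (i, j))).
Proof. by move=> F0 Ff; rewrite /nsum esum_rows. Qed.

(** Tonelli applies to the positive and negative parts of [F]. Their row sums need not be the
    positive and negative parts of the row sums of [F]; [rsum_diff] bridges this gap. *)
Lemma rsum_rows (F : T * U -> R) : rsummable F ->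
  rsum F = rsum (fun i => rsum (fun j => F (i, j))).
Proof.
move=> Ff; have Pf := posp_fin Ff; have Nf := negp_fin Ff.
have P k : 0 <= Num.max (F k) 0 by exact: posp_ge0.
have Q k : 0 <= Num.max (- F k) 0 by exact: posp_ge0.
rewrite [LHS]/rsum !nsum_rows// -rsum_diff//.
- by move=> i; apply: nsum_ge0.
- by move=> i; apply: nsum_ge0.
- exact: (@nfin_nsum (fun k => Num.max (F k) 0)).
- exact: (@nfin_nsum (fun k => Num.max (- F k) 0)).
Qed.

End DoubleSums.

(** * Absolutely summable complex families *)

Section ComplexSums.
Variable R : realType.

Definition csummable (T : choiceType) (f : T -> R[i]) := nfin (fun i => cmod (f i)).

Definition csum (T : choiceType) (f : T -> R[i]) : R[i] :=
  rsum (fun i => complex.Re (f i)) +i* rsum (fun i => complex.Im (f i)).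

Lemma csummable_Re (T : choiceType) (f : T -> R[i]) :
  csummable f -> rsummable (fun i => complex.Re (f i)).
Proof. by apply: nfin_le => i; exact: Re_le_cmod. Qed.

Lemma csummable_Im (T : choiceType) (f : T -> R[i]) :
  csummable f -> rsummable (fun i => complex.Im (f i)).
Proof. by apply: nfin_le => i; exact: Im_le_cmod. Qed.

Variable T : choiceType.
Implicit Types f g : T -> R[i].

Lemma csummable_le f (g : T -> R) : (forall i, cmod (f i) <= g i) -> nfin g ->
  csummable f.
Proof. exact: nfin_le. Qed.

Lemma csummableD f g : csummable f -> csummable g -> csummable (fun i => f i + g i).
Proof.
move=> ff gf; apply: nfin_le (nfinD _ _ ff gf) => i; try exact: cmod_ge0.
exact: cmodD.
Qed.

Lemma csummableZ (c : R[i]) f : csummable f -> csummable (fun i => c * f i).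
Proof.
move=> ff; apply: nfin_le (nfinZ (cmod_ge0 c) _ ff) => i; last exact: cmod_ge0.
by rewrite cmodM.
Qed.

Lemma csummableN f : csummable f -> csummable (fun i => - f i).
Proof. by rewrite /csummable; under [in X in _ -> X]eq_fun do rewrite cmodN. Qed.

Lemma csumD f g : csummable f -> csummable g ->
  csum (fun i => f i + g i) = csum f + csum g.
Proof.
move=> ff gf; rewrite /csum.
have -> : (fun i => complex.Re (f i + g i)) =
          (fun i => complex.Re (f i) + complex.Re (g i)).
  by apply/funext => i; case: (f i) (g i) => [a b] [c d].
have -> : (fun i => complex.Im (f i + g i)) =
          (fun i => complex.Im (f i) + complex.Im (g i)).
  by apply/funext => i; case: (f i) (g i) => [a b] [c d].
rewrite !rsumD//.
- exact: csummable_Im.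
- exact: csummable_Im.
- exact: csummable_Re.
- exact: csummable_Re.
Qed.

Lemma csumZ (c : R[i]) f : csummable f -> csum (fun i => c * f i) = c * csum f.
Proof.
move=> ff; rewrite /csum; case: c => a b.
have fr := csummable_Re ff; have fi := csummable_Im ff.
have -> : (fun i => complex.Re ((a +i* b) * f i)) =
          (fun i => a * complex.Re (f i) + (- b) * complex.Im (f i)).
  by apply/funext => i; case: (f i) => [c d] /=; rewrite mulNr.
have -> : (fun i => complex.Im ((a +i* b) * f i)) =
          (fun i => a * complex.Im (f i) + b * complex.Re (f i)).
  by apply/funext => i; case: (f i) => [c d] /=.
rewrite !rsumD ?rsumZ//; try exact: rsummableZ.
by apply/eqP; rewrite eq_complex /= mulNr !eqxx.
Qed.

Lemma csumN f : csum (fun i => - f i) = - csum f.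
Proof.
rewrite /csum.
have -> : (fun i => complex.Re (- f i)) = (fun i => - complex.Re (f i)).
  by apply/funext => i; case: (f i).
have -> : (fun i => complex.Im (- f i)) = (fun i => - complex.Im (f i)).
  by apply/funext => i; case: (f i).
by rewrite !rsumN.
Qed.

Lemma csumB f g : csummable f -> csummable g ->
  csum (fun i => f i - g i) = csum f - csum g.
Proof. by move=> ff gf; rewrite csumD ?csumN//; exact: csummableN. Qed.

Lemma csum0 : csum (fun _ : T => 0 : R[i]) = 0.
Proof.
rewrite /csum (_ : rsum _ = 0); last first.
  by rewrite rsum_nonneg// /nsum esum1.
by [].
Qed.

Lemma csummable_inj (U : choiceType) (e : U -> T) f : injective e ->
  (forall k, (forall i, k <> e i) -> f k = 0) ->
  csummable (fun i => f (e i)) -> csummable f.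
Proof.
move=> inje f0; rewrite /csummable /nfin (esum_injP inje)//.
by move=> k /f0 ->; rewrite cmod0.
Qed.

Lemma csum_inj (U : choiceType) (e : U -> T) f : injective e ->
  (forall k, (forall i, k <> e i) -> f k = 0) ->
  csum f = csum (fun i => f (e i)).
Proof.
move=> inje f0; rewrite /csum (rsum_inj inje); last by move=> k /f0 ->.
by rewrite [X in _ +i* X](rsum_inj inje)// => k /f0 ->.
Qed.

(** Rotation: after multiplication by a [u] of modulus 1 the sum is real and nonnegative, and
    [Re (u * f i)] is at most [cmod (f i)]. A zero sum is set apart because [u] is a quotient by the
    sum. *)
Lemma csum_norm f : csummable f -> cmod (csum f) <= nsum (fun i => cmod (f i)).
Proof.
move=> ff; have n0 i : 0 <= cmod (f i) by exact: cmod_ge0.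
have [s0|s0] := eqVneq (csum f) 0; first by rewrite s0 cmod0 nsum_ge0.
set u := `|csum f| / csum f.
have u1 : cmod u = 1.
  by rewrite /u cmodM cmodV {1}/cmod normr_id -/(cmod _) divff// cmod_eq0.
have -> : cmod (csum f) = rsum (fun i => complex.Re (u * f i)).
  transitivity (complex.Re (csum (fun i => u * f i))); last by [].
  by rewrite csumZ// /u divfK.
rewrite -rsum_nonneg//; apply: rsum_le.
- exact/csummable_Re/csummableZ.
- by rewrite /rsummable; under eq_fun do rewrite ger0_norm//.
- move=> i; apply: (le_trans (ler_norm _)); apply: (le_trans (Re_le_cmod _)).
  by rewrite cmodM u1 mul1r.
Qed.

Lemma csummable_delta (k0 : T) (z : R[i]) :
  csummable (fun k => if k == k0 then z else 0) /\
  nsum (fun k => cmod (if k == k0 then z else 0)) = cmod z.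
Proof.
have h : (\esum_(k in [set: T]) (cmod (if k == k0 then z else 0))%:E =
   (cmod z)%:E)%E.
  rewrite -(@esum_set1 R T k0 (fun=> (cmod z)%:E)) ?lee_fin ?cmod_ge0//.
  rewrite [RHS]esum_mkcond; apply: eq_esum => k _; rewrite in_set1.
  by case: (k == k0); rewrite ?cmod0.
by split; [rewrite /csummable /nfin h ltry|rewrite /nsum h].
Qed.

Lemma csum_delta (k0 : T) (z : R[i]) :
  csum (fun k => if k == k0 then z else 0) = z.
Proof.
have h (x : R) : rsum (fun k => if k == k0 then x else 0) = x.
  have h (y : R) : 0 <= y -> nsum (fun k => if k == k0 then y else 0) = y.
    move=> y0; rewrite /nsum (_ : (\esum_(k in _) _)%E = y%:E)//.
    rewrite -(@esum_set1 R T k0 (fun=> y%:E)) ?lee_fin//.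
    rewrite [RHS]esum_mkcond; apply: eq_esum => k _; rewrite in_set1.
    by case: (k == k0).
  rewrite /rsum [RHS]posp_negp; congr (_ - _).
    rewrite -[RHS]h ?posp_ge0//; congr nsum.
    by apply/funext => k; case: ifP => // _; rewrite maxxx.
  rewrite -[RHS]h ?posp_ge0//; congr nsum.
  by apply/funext => k; case: ifP => // _; rewrite oppr0 maxxx.
rewrite /csum; case: z => a b; congr (_ +i* _).
  by rewrite -[RHS]h; congr rsum; apply/funext => k; case: ifP.
by rewrite -[RHS]h; congr rsum; apply/funext => k; case: ifP.
Qed.

Lemma csummable_sum (I : Type) (s : seq I) (F : I -> T -> R[i]) :
  (forall i, csummable (F i)) -> csummable (fun k => \sum_(i <- s) F i k).
Proof.
move=> Ff; elim: s => [|i s ih].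
  under eq_fun do rewrite big_nil.
  by rewrite /csummable /nfin esum1 ?ltry// => k _; rewrite cmod0.
by under eq_fun do rewrite big_cons; exact: csummableD.
Qed.

Lemma csum_sum (I : Type) (s : seq I) (F : I -> T -> R[i]) :
  (forall i, csummable (F i)) ->
  csum (fun k => \sum_(i <- s) F i k) = \sum_(i <- s) csum (F i).
Proof.
move=> Ff; elim: s => [|i s ih].
  by under eq_fun do rewrite big_nil; rewrite csum0 big_nil.
under eq_fun do rewrite big_cons.
by rewrite csumD// ?ih ?big_cons//; exact: csummable_sum.
Qed.

End ComplexSums.

(** * Fubini for complex families *)

Section ComplexDoubleSums.
Variables (R : realType) (T U : choiceType).

Lemma csummable_row (F : T * U -> R[i]) i : csummable F ->
  csummable (fun j => F (i, j)).
Proof. by apply: (@nfin_row R T U (fun k => cmod (F k))) => k; exact: cmod_ge0. Qed.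

Lemma csum_rows (F : T * U -> R[i]) : csummable F ->
  csum F = csum (fun i => csum (fun j => F (i, j))).
Proof.
move=> Ff; rewrite {1}/csum (rsum_rows (csummable_Re Ff)).
by rewrite (rsum_rows (csummable_Im Ff)).
Qed.

Lemma csummable_csum (F : T * U -> R[i]) : csummable F ->
  csummable (fun i => csum (fun j => F (i, j))).
Proof.
move=> Ff.
apply: (csummable_le (g := fun i => nsum (fun j => cmod (F (i, j))))).
  by move=> i; apply: csum_norm; exact: csummable_row.
by apply: (@nfin_nsum R T U (fun k => cmod (F k))) => // k; exact: cmod_ge0.
Qed.

End ComplexDoubleSums.

Section Interchange.
Variables (R : realType) (T U : choiceType).

Let sw (p : U * T) : T * U := (p.2, p.1).

Lemma sw_inj : injective sw.
Proof. by move=> [a b] [c d] [-> ->]. Qed.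

Lemma csummable_swap (F : T * U -> R[i]) : csummable F ->
  csummable (fun p : U * T => F (p.2, p.1)).
Proof.
rewrite /csummable /nfin (@esum_injP _ _ _ sw _ sw_inj)//.
by move=> [a b] /(_ (b, a)).
Qed.

Lemma csum_swap (F : T -> U -> R[i]) : csummable (fun p => F p.1 p.2) ->
  csum (fun i => csum (F i)) = csum (fun j => csum (fun i => F i j)).
Proof.
move=> Ff; rewrite -(csum_rows Ff) (csum_inj sw_inj); last first.
  by move=> [a b] /(_ (b, a)).
by rewrite (csum_rows (csummable_swap Ff)).
Qed.

End Interchange.

(** * Unordered sums as limits of series *)

Section SequenceSums.
Variable R : realType.

(** The radii of balls in [R[i]^o] are positive elements of [R[i]], hence real; this trades them for
    radii in [R]. *)
Lemma cvg_cmodP (u : nat -> R[i]) (l : R[i]) :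
  (forall e : R, 0 < e -> exists n, forall m, (n <= m)%N -> cmod (l - u m) <= e) ->
  (u : nat -> R[i]^o) @ \oo --> (l : R[i]^o).
Proof.
move=> h; apply/cvgrPdist_le => e e0.
have ereal : e = (complex.Re e)%:C by rewrite RRe_real// gtr0_real.
have [n hn] := h (complex.Re e) ltac:(by rewrite -ltcR -ereal).
by exists n => // m /= nm; rewrite ereal -cmodE lecR hn.
Qed.

(** The truncated sequence is a finite sum of families concentrated at one index. *)
Lemma csum_partial (f : nat -> R[i]) n :
  csum (fun k => if (k < n)%N then f k else 0) = \sum_(k < n) f k.
Proof.
transitivity (csum (fun k => \sum_(i <- enum 'I_n) (if k == i :> nat then f i else 0))).
  congr csum; apply/funext => k; rewrite big_enum/=.
  case: ifPn => kn; last first.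
    by rewrite big1// => i _; case: eqP => // ki; rewrite ki ltn_ord in kn.
  rewrite (bigD1 (Ordinal kn))//= eqxx big1 ?addr0// => i /eqP ik.
  by case: eqP => // ki; case: ik; apply: val_inj.
rewrite csum_sum; last by move=> i; have [] := csummable_delta (i : nat) (f i).
by rewrite big_enum/=; apply: eq_bigr => i _; rewrite csum_delta.
Qed.

(** Past every index of the finite set given by [nfin_tail], what a partial sum omits is dominated
    by the tail off that set. *)
Lemma csum_cvg (f : nat -> R[i]) : csummable f ->
  (series (f : nat -> R[i]^o)) @ \oo --> (csum f : R[i]^o).
Proof.
move=> ff; apply: cvg_cmodP => e e0.
have [A finA hA] := nfin_tail (fun i => cmod_ge0 (f i)) ff e0.
have [n An] : exists n, forall k, A k -> (k < n)%N.
  have := finA; rewrite finite_seqP => -[s ->].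
  exists (\max_(k <- s) k).+1 => k /= ks; rewrite ltnS.
  exact: leq_bigmax_seq.
exists n => m nm; rewrite /series/= big_mkord -csum_partial -csumB//; last first.
  by apply: csummable_le ff => k; case: ifP; rewrite ?cmod0 ?cmod_ge0.
set g := fun k => _.
have gle k : cmod (g k) <= (if k \in A then 0 else cmod (f k)).
  rewrite /g; case: ifPn => km.
    by rewrite subrr cmod0; case: ifP; rewrite ?cmod_ge0.
  rewrite subr0; case: ifPn => // /[!inE] /An kn; move: km.
  by rewrite (leq_trans kn nm).
have q0 k : 0 <= (if k \in A then 0 else cmod (f k)) by case: ifP; rewrite ?cmod_ge0.
apply: (le_trans (csum_norm _)).
  by apply: csummable_le gle _; exact: nfin_bound hA.
apply: le_trans (nsum_bound q0 hA); apply: le_nsum => //.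
  by move=> k; exact: cmod_ge0.
exact: nfin_bound hA.
Qed.

Lemma csum_lim (f : nat -> R[i]) : csummable f ->
  limn (series (f : nat -> R[i]^o)) = csum f.
Proof. by move=> ff; apply: cvg_lim => //; exact: csum_cvg. Qed.

End SequenceSums.

(** * Recovering coefficients from values on the unit circle *)

Section Averaging.
Variable R : realType.

(** [X^n - 1] splits over [R[i]] and is separable in characteristic zero; its [n] distinct roots
    include a primitive one. *)
Lemma prim_root_complex n : (0 < n)%N -> exists w : R[i], n.-primitive_root w.
Proof.
move=> n0; have pm : 'X^n - 1 \is @monic R[i] by rewrite monicXnsubC.
have [r dp] := closed_field_poly_normal ('X^n - 1 : {poly R[i]}).
have {dp} dp : 'X^n - 1 = \prod_(z <- r) ('X - z%:P).
  by rewrite dp (monicP pm) scale1r.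
have rn1 : all n.-unity_root r by apply/allP => z; rewrite -root_prod_XsubC -dp.
have szr : (n < (size r).+1)%N by rewrite -(size_prod_XsubC r id) -dp size_XnsubC.
have [|w] := hasP (has_prim_root n0 rn1 _ szr); last by exists w.
rewrite -separable_prod_XsubC -dp separable_Xn_sub_1//.
by rewrite pnatr_eq0 -lt0n.
Qed.

Lemma cmod_prim_root n (w : R[i]) : n.-primitive_root w -> cmod w = 1.
Proof.
move=> hw; have n0 := prim_order_gt0 hw.
have := congr1 (@cmod R) (prim_expr_order hw).
rewrite cmod1 (cmodXz w n) => /eqP.
by rewrite -[_ ^ _]/(_ ^+ n) pexpr_eq1 ?cmod_ge0// => /eqP.
Qed.

(** [w ^ k] is not 1 because [n] does not divide [k], and the geometric sum times [w ^ k - 1]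
    telescopes to [(w ^ n) ^ k - 1 = 0]. *)
Lemma root_avg n (w : R[i]) (k : int) : n.-primitive_root w -> k != 0 ->
  (`|k| < n)%N -> \sum_(j < n) (w ^+ j) ^ k = 0.
Proof.
move=> hw k0 kn; have n0 := prim_order_gt0 hw.
have w0 : w != 0 by rewrite -cmod_eq0 (cmod_prim_root hw) oner_eq0.
have wk : w ^ k != 1.
  case: k k0 kn => m; rewrite ?NegzE /= => m0 mn.
    rewrite -[_ ^ _]/(w ^+ m) -(prim_order_dvd hw); apply/negP => /dvdn_leq.
    by move=> /(_ ltac:(lia)); lia.
  rewrite -[_ ^ _]/(w ^- m.+1) invr_eq1 -(prim_order_dvd hw); apply/negP => /dvdn_leq.
  by move=> /(_ isT); lia.
have -> : \sum_(j < n) (w ^+ j) ^ k = \sum_(j < n) (w ^ k) ^+ j.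
  by apply: eq_bigr => j _; rewrite !exprnP exprzAC.
have wk' : w ^ k - 1 != 0 by rewrite subr_eq0.
apply: (mulfI wk'); rewrite mulr0.
by rewrite -subrX1 exprnP exprzAC -exprnP (prim_expr_order hw) exp1rz subrr.
Qed.

(** An unordered sum over all of [int], to which Fubini applies; on the circle [ev_plus_minus]
    identifies it with the sum of the two limits used in [weval]. *)
Definition ev (c : int -> R[i]) (t : R[i]) : R[i] := csum (fun k => c k * t ^ k).

Lemma cmod_unitXz (t : R[i]) (k : int) : cmod t = 1 -> cmod (t ^ k) = 1.
Proof. by move=> t1; rewrite cmodXz t1 exp1rz. Qed.

Lemma unit_neq0 (t : R[i]) : cmod t = 1 -> t != 0.
Proof. by move=> t1; rewrite -cmod_eq0 t1 oner_eq0. Qed.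

Lemma csummable_ev (c : int -> R[i]) (t : R[i]) : cmod t = 1 -> csummable c ->
  csummable (fun k => c k * t ^ k).
Proof.
move=> t1; rewrite /csummable.
by under [in X in _ -> X]eq_fun do rewrite cmodM cmod_unitXz// mulr1.
Qed.

(* Averaging over the n-th roots of unity removes every coefficient with
   0 < |k| < n. *)
Lemma coef0_le (c : int -> R[i]) (M : R) : csummable c ->
  (forall t, cmod t = 1 -> cmod (ev c t) <= M) -> cmod (c 0) <= M.
Proof.
move=> cf hM; apply/ler_addgt0Pr => e e0.
have [A finA hA] := nfin_tail (fun i => cmod_ge0 (c i)) cf e0.
have [n n0 An] : exists2 n, (0 < n)%N & forall k, A k -> (`|k| < n)%N.
  have := finA; rewrite finite_seqP => -[s ->].
  exists (\max_(k <- s) `|k|%N).+1 => // k /= ks; rewrite ltnS.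
  exact: (@leq_bigmax_seq _ _ xpredT (fun k : int => `|k|%N)).
have [w hw] := prim_root_complex n0; have w1 := cmod_prim_root hw.
have nC : n%:R != 0 :> R[i] by rewrite pnatr_eq0 -lt0n.
have cn : cmod (n%:R^-1 : R[i]) = n%:R^-1.
  by rewrite cmodV -(rmorph_nat (real_complex R)) cmod_real ger0_norm.
pose g k : R[i] := n%:R^-1 * \sum_(j < n) (w ^+ j) ^ k.
have wj j : cmod (w ^+ j) = 1 by rewrite (cmod_unitXz j%:Z w1).
have g1 k : cmod (g k) <= 1.
  rewrite /g cmodM cn ler_pdivrMl ?ltr0n// mulr1 (le_trans (cmod_sum _ _ _))//.
  under eq_bigr do rewrite cmod_unitXz//.
  by rewrite sumr_const card_ord.
have g0 : g 0 = 1.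
  by rewrite /g; under eq_bigr do rewrite expr0z; rewrite sumr_const card_ord mulVf.
have gA k : A k -> k != 0 -> g k = 0.
  by move=> Ak k0; rewrite /g (root_avg hw k0 (An _ Ak)) mulr0.
have cgf : csummable (fun k => c k * g k).
  by apply: csummable_le cf => k; rewrite cmodM ler_piMr ?cmod_ge0.
have havg : csum (fun k => c k * g k) = n%:R^-1 * \sum_(j < n) ev c (w ^+ j).
  have jf (j : 'I_n) : csummable (fun k => c k * (w ^+ j) ^ k).
    exact: csummable_ev.
  rewrite -[X in _ * X]big_enum/= -csum_sum// -csumZ; last exact: csummable_sum.
  congr csum; apply/funext => k; rewrite /g mulrCA big_enum/=.
  by congr (_ * _); rewrite mulr_sumr.
have avgM : cmod (csum (fun k => c k * g k)) <= M.
  rewrite havg cmodM cn ler_pdivrMl ?ltr0n//.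
  apply: (le_trans (cmod_sum _ _ _)).
  apply: (@le_trans _ _ (\sum_(j < n) M)); first by apply: ler_sum => j _; exact: hM.
  by rewrite sumr_const card_ord mulr_natl.
have [df _] := csummable_delta (0 : int) (c 0).
have -> : c 0 = csum (fun k => c k * g k) +
    csum (fun k => (if k == 0 then c 0 else 0) - c k * g k).
  by rewrite csumB// csum_delta addrC subrK.
rewrite (le_trans (cmodD _ _))// lerD//.
(* The error of the average: it vanishes at 0 and on [A], and elsewhere [cmod (g k) <= 1] keeps it
   below the tail. *)
set h := fun k => _.
have hle k : cmod (h k) <= (if k \in A then 0 else cmod (c k)).
  rewrite /h; have [->|k0] := eqVneq k 0.
    by rewrite g0 mulr1 subrr cmod0; case: ifP; rewrite ?cmod_ge0.
  rewrite sub0r cmodN; case: ifPn => [/[!inE] Ak|_]; first by rewrite gA// mulr0 cmod0.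
  by rewrite cmodM ler_piMr ?cmod_ge0.
have q0 k : 0 <= (if k \in A then 0 else cmod (c k)) by case: ifP; rewrite ?cmod_ge0.
have qf := nfin_bound hA.
apply: (le_trans (csum_norm (csummable_le hle qf))).
apply: le_trans (nsum_bound q0 hA); apply: le_nsum => // k; exact: cmod_ge0.
Qed.

Lemma addz_inj (m : int) : injective (fun k : int => k + m).
Proof. exact: addIr. Qed.

Lemma addz_surj (m k : int) : ~ (forall i : int, k <> i + m).
Proof. by move/(_ (k - m)); rewrite subrK. Qed.

(** Multiplication by [t ^ (- m)] moves the coefficient [m] to 0 and preserves the modulus on the
    circle. *)
Lemma coef_le (c : int -> R[i]) (M : R) (m : int) : csummable c ->
  (forall t, cmod t = 1 -> cmod (ev c t) <= M) -> cmod (c m) <= M.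
Proof.
move=> cf hM; rewrite -[m]add0r.
have c'f : csummable (fun k => c (k + m)).
  move: cf; rewrite /csummable /nfin.
  rewrite (@esum_injP _ _ _ _ (fun k => (cmod (c k))%:E) (@addz_inj m))//.
  by move=> k /addz_surj.
apply: (@coef0_le (fun k => c (k + m))) => // t t1.
have -> : ev (fun k => c (k + m)) t = t ^ (- m) * ev c t.
  rewrite /ev [X in _ * X](csum_inj (@addz_inj m)); last by move=> k /addz_surj.
  rewrite -csumZ; last first.
    by apply: csummable_le c'f => k; rewrite cmodM cmod_unitXz// mulr1.
  congr csum; apply/funext => k.
  by rewrite mulrCA -expfzDr ?unit_neq0// addrCA addNr addr0.
by rewrite cmodM cmod_unitXz// mul1r hM.
Qed.

(** [coef_le] with bound 0 for the difference. The multiplicative laws of the algebra are deduced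
    from this uniqueness. *)
Lemma ev_inj (c d : int -> R[i]) : csummable c -> csummable d ->
  (forall t, cmod t = 1 -> ev c t = ev d t) -> c = d.
Proof.
move=> cf df h; apply/funext => k; apply/eqP; rewrite -subr_eq0 -cmod_eq0.
rewrite eq_le cmod_ge0 andbT; apply: (@coef_le (fun k => c k - d k)).
  exact/csummableD/csummableN.
move=> t t1; rewrite /ev; under eq_fun do rewrite mulrBl.
by rewrite csumB -/(ev c t) -/(ev d t) ?h ?subrr ?cmod0//; exact: csummable_ev.
Qed.

End Averaging.

(** * Cauchy products *)

Section Convolution.
Variable R : realType.
Implicit Types c d : int -> R[i].

Definition conv c d (n : int) : R[i] := csum (fun k => c k * d (n - k)).

Lemma esum_shift (f : int -> \bar R) (k : int) :
  (\esum_(n in [set: int]) f (n - k)%R = \esum_(n in [set: int]) f n)%E.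
Proof. by rewrite [RHS](esum_injP (@addz_inj (- k)))// => n /addz_surj. Qed.

(** With [k = p.1] fixed, the shift by [k] turns the inner sum into [cmod (c k)] times the norm of
    [d]. Summability over pairs is what Fubini requires in [ev_conv]. *)
Lemma esum_conv c d : csummable c -> csummable d ->
  (\esum_(p in [set: int * int]) (cmod (c p.1 * d (p.2 - p.1)))%:E <=
   (nsum (fun k => cmod (c k)) * nsum (fun k => cmod (d k)))%:E)%E.
Proof.
move=> cf df; have c0 k : 0 <= cmod (c k) by exact: cmod_ge0.
have d0 k : 0 <= cmod (d k) by exact: cmod_ge0.
rewrite (esum_pairs (F := fun p => cmod (c p.1 * d (p.2 - p.1)))); last first.
  by move=> p; exact: cmod_ge0.
have h k : (\esum_(n in [set: int]) (cmod (c k * d (n - k)))%:E <=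
            (nsum (fun k => cmod (d k)) * cmod (c k))%:E)%E.
  rewrite (esum_shift (fun n => (cmod (c k * d n))%:E)) mulrC.
  under eq_esum do rewrite cmodM.
  exact: esumZ_le.
apply: (@le_trans _ _ (\esum_(k in [set: int])
    (nsum (fun k => cmod (d k)) * cmod (c k))%:E)%E).
  by apply: le_esum => k _; exact: h.
by rewrite mulrC; apply: esumZ_le => //; exact: nsum_ge0.
Qed.

Lemma csummable_conv2 c d : csummable c -> csummable d ->
  csummable (fun p : int * int => c p.1 * d (p.2 - p.1)).
Proof. by move=> cf df; exact: nfin_bound (esum_conv cf df). Qed.

Lemma csummable_conv c d : csummable c -> csummable d -> csummable (conv c d).
Proof.
move=> cf df.
exact: csummable_csum (csummable_swap (csummable_conv2 cf df)).
Qed.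

Lemma nsum_conv c d : csummable c -> csummable d ->
  nsum (fun n => cmod (conv c d n)) <=
  nsum (fun k => cmod (c k)) * nsum (fun k => cmod (d k)).
Proof.
move=> cf df; have F := csummable_swap (csummable_conv2 cf df).
have F0 (p : int * int) : 0 <= cmod (c p.2 * d (p.1 - p.2)) by exact: cmod_ge0.
apply: (@le_trans _ _ (nsum (fun n => nsum (fun k => cmod (c k * d (n - k)))))).
  apply: le_nsum.
  - by move=> n; exact: cmod_ge0.
  - by move=> n; apply: csum_norm; exact: (csummable_row n F).
  - exact: (nfin_nsum F0 F).
rewrite -(nsum_rows F0 F); apply: nsum_bound => //.
apply: le_trans (esum_conv cf df).
have sw_inj : injective (fun p : int * int => (p.2, p.1)).
  by move=> [a b] [a' b'] [-> ->].
by rewrite [leRHS](esum_injP sw_inj)// => -[a b] /(_ (b, a)).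
Qed.

Lemma ev_conv c d t : cmod t = 1 -> csummable c -> csummable d ->
  ev (conv c d) t = ev c t * ev d t.
Proof.
move=> t1 cf df; have t0 := unit_neq0 t1.
have F : csummable (fun p : int * int => c p.1 * d (p.2 - p.1) * t ^ p.2).
  apply: csummable_le (csummable_conv2 cf df) => p.
  by rewrite [leLHS]cmodM cmod_unitXz// mulr1.
transitivity (csum (fun n => csum (fun k => c k * d (n - k) * t ^ n))).
  congr csum; apply/funext => n; rewrite mulrC -csumZ; last first.
    exact: (csummable_row n (csummable_swap (csummable_conv2 cf df))).
  by congr csum; apply/funext => k; rewrite mulrC.
rewrite -(csum_swap F) mulrC -csumZ; last exact: csummable_ev.
congr csum; apply/funext => k.
rewrite mulrC -csumZ; last exact: csummable_ev.
rewrite [RHS](csum_inj (@addz_inj (- k))); last by move=> n /addz_surj.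
congr csum; apply/funext => n.
by rewrite mulrACA -expfzDr// addrCA subrr addr0.
Qed.

End Convolution.

(** * The scalar Wiener algebra as a commutative ring *)

Section WienerRing.
Variable R : realType.

Record l1 := L1 { lcoef :> int -> R[i]; lcoefP : csummable lcoef }.

HB.instance Definition _ := gen_eqMixin l1.
HB.instance Definition _ := gen_choiceMixin l1.

Implicit Types x y z : l1.

(** [csummable] unfolds to a boolean inequality, so the summability proofs of equal families
    coincide. *)
Lemma l1_coefP x y : lcoef x =1 lcoef y -> x = y.
Proof.
case: x y => [c cf] [d df] /= /funext cd.
by rewrite cd in cf *; congr L1; exact: bool_irrelevance.
Qed.

Definition l1_add x y := L1 (csummableD (lcoefP x) (lcoefP y)).
Definition l1_opp x := L1 (csummableN (lcoefP x)).
Definition l1_mul x y := L1 (csummable_conv (lcoefP x) (lcoefP y)).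
Definition lmono (k : int) (z : R[i]) := L1 (csummable_delta k z).1.

Fact l1_addA : associative l1_add.
Proof. by move=> x y z; apply: l1_coefP => k /=; rewrite addrA. Qed.
Fact l1_addC : commutative l1_add.
Proof. by move=> x y; apply: l1_coefP => k /=; rewrite addrC. Qed.
Fact l1_add0 : left_id (lmono 0 0) l1_add.
Proof. by move=> x; apply: l1_coefP => k /=; rewrite if_same add0r. Qed.
Fact l1_addN : left_inverse (lmono 0 0) l1_opp l1_add.
Proof. by move=> x; apply: l1_coefP => k /=; rewrite if_same addNr. Qed.

HB.instance Definition _ := GRing.isZmodule.Build l1
  l1_addA l1_addC l1_add0 l1_addN.

Lemma lcoefD x y k : (x + y) k = x k + y k. Proof. by []. Qed.
Lemma lcoefN x k : (- x) k = - x k. Proof. by []. Qed.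
Lemma lcoef0 k : (0 : l1) k = 0. Proof. by rewrite /= if_same. Qed.

Lemma l1_evP x y : (forall t, cmod t = 1 -> ev x t = ev y t) -> x = y.
Proof.
move=> h; apply: l1_coefP => k.
by rewrite (ev_inj (lcoefP x) (lcoefP y) h).
Qed.

Lemma ev_add x y t : cmod t = 1 -> ev (x + y) t = ev x t + ev y t.
Proof.
move=> t1; rewrite /ev -csumD; try by apply: csummable_ev => //; exact: lcoefP.
by congr csum; apply/funext => k; rewrite mulrDl.
Qed.

Lemma ev_mul x y t : cmod t = 1 -> ev (l1_mul x y) t = ev x t * ev y t.
Proof. by move=> t1; apply: ev_conv => //; exact: lcoefP. Qed.

Lemma ev_mono k (z : R[i]) t : ev (lmono k z) t = z * t ^ k.
Proof.
rewrite /ev -[RHS](csum_delta k); congr csum; apply/funext => j /=.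
by case: eqP => [->|]; rewrite ?mul0r.
Qed.

(** Directly on convolutions this would be an exchange of triple sums; evaluation on the circle
    turns each law into the one for complex numbers. *)
Fact l1_mulA : associative l1_mul.
Proof. by move=> x y z; apply: l1_evP => t t1; rewrite !ev_mul// mulrA. Qed.
Fact l1_mulC : commutative l1_mul.
Proof. by move=> x y; apply: l1_evP => t t1; rewrite !ev_mul// mulrC. Qed.
Fact l1_mul1 : left_id (lmono 0 1) l1_mul.
Proof.
by move=> x; apply: l1_evP => t t1; rewrite !ev_mul// ev_mono expr0z !mul1r.
Qed.
Fact l1_mulDl : left_distributive l1_mul +%R.
Proof.
move=> x y z; apply: l1_evP => t t1.
by rewrite !(ev_mul, ev_add)// mulrDl.
Qed.
Fact l1_oner_neq0 : lmono 0 1 != 0.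
Proof.
apply/eqP => /(congr1 (fun x : l1 => x 0)); rewrite lcoef0 /=.
by move/eqP; rewrite oner_eq0.
Qed.

HB.instance Definition _ := GRing.Zmodule_isComNzRing.Build l1
  l1_mulA l1_mulC l1_mul1 l1_mulDl l1_oner_neq0.

Lemma lcoefM x y : (x * y : l1) = conv x y :> (int -> R[i]). Proof. by []. Qed.

(* Off the unit circle [t] is replaced by 1, which makes evaluation a ring
   morphism for every [t]. *)
Definition lev (t : R[i]) x : R[i] := ev x (if cmod t == 1 then t else 1).

Lemma levE t x : cmod t = 1 -> lev t x = ev x t.
Proof. by rewrite /lev => ->; rewrite eqxx. Qed.

Fact lev_circle t : cmod (if cmod t == 1 then t else (1 : R[i])) = 1.
Proof. by case: eqP => // _; rewrite cmod1. Qed.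

Fact lev_additive t : zmod_morphism (lev t).
Proof.
move=> x y; apply/eqP; rewrite eq_sym subr_eq; apply/eqP.
by rewrite /lev -ev_add ?subrK//; exact: lev_circle.
Qed.

Fact lev_multiplicative t : monoid_morphism (lev t).
Proof.
split; first by rewrite /lev ev_mono expr0z mulr1.
by move=> x y; apply: ev_mul; exact: lev_circle.
Qed.

HB.instance Definition _ t :=
  GRing.isZmodMorphism.Build l1 R[i] (lev t) (lev_additive t).
HB.instance Definition _ t :=
  GRing.isMonoidMorphism.Build l1 R[i] (lev t) (lev_multiplicative t).

Lemma l1_levP x y : (forall t, cmod t = 1 -> lev t x = lev t y) -> x = y.
Proof. by move=> h; apply: l1_evP => t t1; rewrite -!levE ?h. Qed.

Lemma lev_mono k (z : R[i]) t : cmod t = 1 -> lev t (lmono k z) = z * t ^ k.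
Proof. by move=> t1; rewrite levE// ev_mono. Qed.

Definition lnorm x : R := nsum (fun k => cmod (x k)).

Lemma lnormE x : (\esum_(k in [set: int]) (cmod (x k))%:E)%E = (lnorm x)%:E.
Proof. by apply: nsumE; [move=> k; exact: cmod_ge0|exact: lcoefP]. Qed.

Lemma lnorm_ge0 x : 0 <= lnorm x.
Proof. by apply: nsum_ge0 => k; exact: cmod_ge0. Qed.

Lemma lnormD x y : lnorm (x + y) <= lnorm x + lnorm y.
Proof.
have c0 (z : l1) k : 0 <= cmod (z k) by exact: cmod_ge0.
have fx := lcoefP x; have fy := lcoefP y.
rewrite /lnorm -(nsumD (c0 x) (c0 y))//; apply: le_nsum => //.
- by move=> k; exact: cmodD.
- exact: nfinD.
Qed.

Lemma lnormN x : lnorm (- x) = lnorm x.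
Proof. by rewrite /lnorm; under eq_fun do rewrite cmodN. Qed.

Lemma lnormM x y : lnorm (x * y) <= lnorm x * lnorm y.
Proof. by apply: nsum_conv; exact: lcoefP. Qed.

Lemma lnorm_mono k (z : R[i]) : lnorm (lmono k z) = cmod z.
Proof. exact: (csummable_delta k z).2. Qed.

Lemma lnorm0 : lnorm 0 = 0.
Proof. by rewrite lnorm_mono cmod0. Qed.

Lemma lnorm_sum (I : Type) (s : seq I) (P : pred I) (F : I -> l1) :
  lnorm (\sum_(i <- s | P i) F i) <= \sum_(i <- s | P i) lnorm (F i).
Proof.
elim/big_rec2: _ => [|i u v _ h]; first by rewrite lnorm0.
by rewrite (le_trans (lnormD _ _))// lerD2l.
Qed.

Lemma coef_le_lnorm x k : cmod (x k) <= lnorm x.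
Proof.
have -> : cmod (x k) = nsum (fun j => cmod (if j == k then x k else 0)).
  by rewrite (csummable_delta k (x k)).2.
apply: le_nsum; [by move=> j; exact: cmod_ge0| |exact: lcoefP].
by move=> j; case: eqP => [->|]; rewrite ?cmod0 ?cmod_ge0.
Qed.

Lemma lnorm_le0 x : lnorm x <= 0 -> x = 0.
Proof.
move=> x0; apply: l1_coefP => k; rewrite lcoef0; apply/eqP.
by rewrite -cmod_eq0 eq_le cmod_ge0 (le_trans (coef_le_lnorm _ _)).
Qed.

End WienerRing.

(** * Norm-summable series in the algebra *)

Section Completeness.
Variable R : realType.

Lemma esum_geometric (f : nat -> R) (A q : R) : 0 <= q -> q < 1 -> 0 <= A ->
  (forall n, 0 <= f n) -> (forall n, f n <= A * q ^+ n) ->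
  (\esum_(n in [set: nat]) (f n)%:E <= (A / (1 - q))%:E)%E.
Proof.
move=> q0 q1 A0 f0 fA; have q1' : 0 < 1 - q by rewrite subr_gt0.
rewrite -nneseries_esumT; last by move=> n; rewrite lee_fin.
apply: lime_le; first by apply: is_cvg_nneseries => n _ _; rewrite lee_fin.
apply: nearW => n; rewrite sumEFin lee_fin.
apply: (@le_trans _ _ (\sum_(0 <= i < n) A * q ^+ i)).
  by apply: ler_sum => i _; exact: fA.
rewrite big_mkord -mulr_sumr ler_wpM2l// -[leRHS]mul1r ler_pdivlMr// mulrC.
have := subrX1 q n => /(congr1 -%R); rewrite opprB -mulNr opprB => <-.
by rewrite gerBl exprn_ge0.
Qed.

Lemma csum_recl (f : nat -> R[i]) : csummable f ->
  csum f = f 0%N + csum (fun n => f n.+1).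
Proof.
move=> ff; have [df _] := csummable_delta 0%N (f 0%N).
have gf : csummable (fun k => if k == 0%N then 0 else f k).
  by apply: csummable_le ff => k; case: ifP; rewrite ?cmod0 ?cmod_ge0.
transitivity (csum (fun k => (if k == 0%N then f 0%N else 0) +
                             (if k == 0%N then 0 else f k))).
  by congr csum; apply/funext => -[|k] /=; rewrite ?addr0 ?add0r.
rewrite csumD// csum_delta; congr (_ + _).
rewrite (csum_inj succn_inj)// => -[|k] h //.
by case: (h k).
Qed.

Variables (u : nat -> l1 R).
Hypothesis uf : nfin (fun n => lnorm (u n)).

Lemma csummable_family : csummable (fun p : nat * int => u p.1 p.2).
Proof.
rewrite /csummable /nfin (esum_pairs (F := fun p => cmod (u p.1 p.2))); last first.
  by move=> p; exact: cmod_ge0.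
by rewrite (eq_esum (b := fun n => (lnorm (u n))%:E))// => n _; rewrite -lnormE.
Qed.

(** Completeness of the algebra: a series with summable norms is summed coefficientwise, and
    summability over [nat * int] puts the result back in the algebra. *)
Definition lsum : l1 R := L1 (csummable_csum (csummable_swap csummable_family)).

Lemma lsumE k : lsum k = csum (fun n => u n k). Proof. by []. Qed.

Lemma lnorm_lsum (M : R) :
  (\esum_(n in [set: nat]) (lnorm (u n))%:E <= M%:E)%E -> lnorm lsum <= M.
Proof.
move=> hM; have F := csummable_swap csummable_family.
have F0 (p : int * nat) : 0 <= cmod (u p.2 p.1) by exact: cmod_ge0.
apply: (@le_trans _ _ (nsum (fun k => nsum (fun n => cmod (u n k))))).
  apply: le_nsum.
  - by move=> k; exact: cmod_ge0.
  - by move=> k; apply: csum_norm; exact: (csummable_row k F).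
  - exact: (nfin_nsum F0 F).
rewrite -(nsum_rows F0 F); apply: nsum_bound => //.
have sw_inj : injective (fun p : nat * int => (p.2, p.1)).
  by move=> [a b] [a' b'] [-> ->].
rewrite (esum_injP sw_inj); last by move=> [a b] /(_ (b, a)).
rewrite (esum_pairs (F := fun p => cmod (u p.1 p.2))); last first.
  by move=> p; exact: cmod_ge0.
by rewrite (eq_esum (b := fun n => (lnorm (u n))%:E))// => n _; rewrite -lnormE.
Qed.

End Completeness.

(** * Matrix norm and Neumann series *)

Section MatrixNorm.
Variables (R : realType) (n : nat).
Implicit Types A B : 'M[l1 R]_n.

(** Norms of entries come first and the column maximum last, the reverse of [coef_norm].
    Submultiplicativity then follows as for scalar matrices, and [mnorm_l1mx] bounds this norm by
    [wnorm]. *)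
Definition mnorm A : R := \big[Num.max/0]_(j < n) \sum_(i < n) lnorm (A i j).

Lemma mnorm_le A (M : R) : 0 <= M ->
  (forall j, \sum_(i < n) lnorm (A i j) <= M) -> mnorm A <= M.
Proof. by move=> M0 h; apply: bigmax_le. Qed.

Lemma col_le_mnorm A j : \sum_(i < n) lnorm (A i j) <= mnorm A.
Proof. exact: (le_bigmax _ (fun j => \sum_(i < n) lnorm (A i j))). Qed.

Lemma mnorm_ge0 A : 0 <= mnorm A.
Proof. exact: bigmax_ge_id. Qed.

Lemma entry_le_mnorm A i j : lnorm (A i j) <= mnorm A.
Proof.
apply: le_trans (col_le_mnorm A j); rewrite (bigD1 i)//= lerDl.
by apply: sumr_ge0 => k _; exact: lnorm_ge0.
Qed.

Lemma mnormD A B : mnorm (A + B) <= mnorm A + mnorm B.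
Proof.
apply: mnorm_le => [|j]; first by rewrite addr_ge0 ?mnorm_ge0.
apply: le_trans (lerD (col_le_mnorm A j) (col_le_mnorm B j)).
by rewrite -big_split/=; apply: ler_sum => i _; rewrite mxE lnormD.
Qed.

Lemma mnormN A : mnorm (- A) = mnorm A.
Proof.
by apply: eq_bigr => j _; apply: eq_bigr => i _; rewrite mxE lnormN.
Qed.

Lemma mnormM A B : mnorm (A *m B) <= mnorm A * mnorm B.
Proof.
apply: mnorm_le => [|j]; first by rewrite mulr_ge0 ?mnorm_ge0.
apply: (@le_trans _ _ (\sum_i \sum_k lnorm (A i k) * lnorm (B k j))).
  apply: ler_sum => i _; rewrite mxE (le_trans (lnorm_sum _ _ _))//.
  by apply: ler_sum => k _; exact: lnormM.
rewrite exchange_big/=.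
apply: (@le_trans _ _ (\sum_k mnorm A * lnorm (B k j))).
  apply: ler_sum => k _; rewrite -mulr_suml ler_wpM2r ?lnorm_ge0//.
  exact: col_le_mnorm.
by rewrite -mulr_sumr ler_wpM2l ?mnorm_ge0// col_le_mnorm.
Qed.

Lemma mnorm_le0 A : mnorm A <= 0 -> A = 0.
Proof.
move=> A0; apply/matrixP => i j; rewrite mxE; apply: lnorm_le0.
exact: le_trans (entry_le_mnorm _ _ _) A0.
Qed.

Lemma le_geometric_le0 (E C q : R) : 0 <= q -> q < 1 ->
  (forall m, E <= C * q ^+ m) -> E <= 0.
Proof.
move=> q0 q1 h; have /cvg_geometric -/(_ C) cv : `|q| < 1 by rewrite ger0_norm.
by apply: (cvgr_to_ge cv); apply: nearW => m; exact: h.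
Qed.

(** [Y] is the sum of the [(- K)^m 1]. [K] is never exchanged with the infinite sum: with [T m] the
    tail from index [m], the defect [Y + K Y - 1] equals [T m + K (T m) - U m] for every [m], and
    this tends to 0. *)
Lemma neumann (K : {additive 'M[l1 R]_n -> 'M[l1 R]_n}) (q : R) : 0 <= q -> q < 1 ->
  (forall A, mnorm (K A) <= q * mnorm A) -> exists Y, Y + K Y = 1%:M.
Proof.
move=> q0 q1 hK; have q1' : 0 < 1 - q by rewrite subr_gt0.
pose U m : 'M[l1 R]_n := iter m (fun A => - K A) 1%:M.
pose C := mnorm 1%:M; have C0 : 0 <= C by exact: mnorm_ge0.
have UC m : mnorm (U m) <= C * q ^+ m.
  elim: m => [|m ih]; first by rewrite expr0 mulr1.
  rewrite /U iterS -/(U m) mnormN (le_trans (hK _))// exprS mulrCA.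
  by rewrite ler_wpM2l.
have Ub (m : nat) i j : (\esum_(k in [set: nat]) (lnorm (U (m + k)%N i j))%:E <=
    (C * q ^+ m / (1 - q))%:E)%E.
  apply: esum_geometric => //.
  - by rewrite mulr_ge0// exprn_ge0.
  - by move=> k; exact: lnorm_ge0.
  - by move=> k; rewrite -mulrA -exprD (le_trans (entry_le_mnorm _ _ _)).
have Uf m i j : nfin (fun k => lnorm (U (m + k)%N i j)) by exact: nfin_bound (Ub m i j).
pose T m : 'M[l1 R]_n := \matrix_(i, j) lsum (Uf m i j).
(* The factor [n%:R] counts the entries of a column, each bounded by the geometric tail. *)
have T0 m : mnorm (T m) <= n%:R * (C / (1 - q)) * q ^+ m.
  apply: mnorm_le => [|j].
    by rewrite !mulr_ge0 ?invr_ge0 ?exprn_ge0// ltW.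
  rewrite -mulrA mulr_natl -[n in leRHS]card_ord -sumr_const; apply: ler_sum => i _.
  by rewrite mxE (le_trans (lnorm_lsum _ (Ub m i j)))// mulrAC.
have TS m : T m = U m + T m.+1.
  apply/matrixP => i j; rewrite !mxE; apply: l1_coefP => k; rewrite lcoefD !lsumE.
  rewrite csum_recl; last first.
    exact: (csummable_row k (csummable_swap (csummable_family (Uf m i j)))).
  by rewrite addn0; congr (_ + csum _); apply/funext => p; rewrite addnS.
have TK m : T 0%N + K (T 0%N) - 1%:M = T m + K (T m) - U m.
  elim: m => [//|m ->]; rewrite (_ : U m.+1 = - K (U m))// opprK (TS m) raddfD/=.
  by rewrite addrAC [U m + _]addrC addrK [K (U m) + _]addrC addrA.
exists (T 0%N); apply/eqP; rewrite -subr_eq0; apply/eqP/mnorm_le0.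
(* [1 + q] accounts for [T m] and [K (T m)], the last [C] for [U m]. *)
apply: (@le_geometric_le0 _ ((1 + q) * (n%:R * (C / (1 - q))) + C) q) => // m.
rewrite (TK m) (le_trans (mnormD _ _))// mnormN mulrDl lerD//.
rewrite (le_trans (mnormD _ _))// -mulrA mulrDl mul1r lerD//.
by rewrite (le_trans (hK _))// ler_wpM2l.
Qed.

End MatrixNorm.

(** * Supports of coefficients and the canonical factorisation *)

Section Supports.
Variable R : realType.
Implicit Types x y : l1 R.

Definition supp (S : pred int) x := forall k, ~~ S k -> x k = 0.

Lemma supp0 S : supp S 0. Proof. by move=> k _; rewrite lcoef0. Qed.

Lemma suppD S x y : supp S x -> supp S y -> supp S (x + y).
Proof. by move=> hx hy k Sk; rewrite lcoefD hx// hy// addr0. Qed.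

Lemma suppM (S S' S'' : pred int) x y : (forall k l, S k -> S' l -> S'' (k + l)) ->
  supp S x -> supp S' y -> supp S'' (x * y).
Proof.
move=> hS hx hy m Sm; rewrite lcoefM /conv.
rewrite (_ : (fun k => _) = (fun=> 0)) ?csum0//; apply/funext => k.
have [Sk|/hx ->] := boolP (S k); last by rewrite mul0r.
have [Sl|/hy ->] := boolP (S' (m - k)); last by rewrite mulr0.
by have := hS _ _ Sk Sl; rewrite addrC subrK (negPf Sm).
Qed.

Lemma supp_mono (S : pred int) k (z : R[i]) : S k -> supp S (lmono k z).
Proof. by move=> Sk j /=; case: eqP => // ->; rewrite Sk. Qed.

Lemma proj_summable (S : pred int) x : csummable (fun k => if S k then x k else 0).
Proof.
by apply: csummable_le (lcoefP x) => k; case: ifP; rewrite ?cmod0 ?cmod_ge0.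
Qed.

Definition proj (S : pred int) x : l1 R := L1 (proj_summable S x).

Fact proj_additive S : zmod_morphism (proj S).
Proof.
move=> x y; apply: l1_coefP => k; rewrite lcoefD lcoefN /=.
by case: ifP; rewrite ?subr0.
Qed.

HB.instance Definition _ S :=
  GRing.isZmodMorphism.Build (l1 R) (l1 R) (proj S) (proj_additive S).

Lemma supp_proj S x : supp S (proj S x).
Proof. by move=> k /= /negPf ->. Qed.

Lemma supp_projC (S S' : pred int) x : (forall k, S' k = ~~ S k) ->
  supp S' (x - proj S x).
Proof.
move=> SS' k; rewrite SS' negbK lcoefD lcoefN /= => ->; exact: subrr.
Qed.

Lemma lnorm_proj S x : lnorm (proj S x) <= lnorm x.
Proof.
apply: le_nsum; [by move=> k; exact: cmod_ge0| |exact: lcoefP].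
by move=> k /=; case: ifP; rewrite ?cmod0 ?cmod_ge0.
Qed.

Variable n : nat.
Implicit Types A B : 'M[l1 R]_n.

Definition msupp S A := forall i j, supp S (A i j).

Lemma msuppD S A B : msupp S A -> msupp S B -> msupp S (A + B).
Proof. by move=> hA hB i j; rewrite mxE; exact: suppD. Qed.

Lemma msuppM (S S' S'' : pred int) A B : (forall k l, S k -> S' l -> S'' (k + l)) ->
  msupp S A -> msupp S' B -> msupp S'' (A *m B).
Proof.
move=> hS hA hB i j; rewrite mxE; apply: (big_ind (supp S'')).
- exact: supp0.
- by move=> x y; exact: suppD.
- by move=> k _; exact: (suppM hS (hA i k) (hB k j)).
Qed.

Lemma msupp1 (S : pred int) : S 0 -> msupp S 1%:M.
Proof.
move=> S0 i j; rewrite mxE; case: (i == j); [exact: supp_mono|exact: supp0].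
Qed.

Lemma mnorm_proj S A : mnorm (map_mx (proj S) A) <= mnorm A.
Proof.
apply: mnorm_le; first exact: mnorm_ge0.
move=> j; apply: le_trans (col_le_mnorm A j); apply: ler_sum => i _.
by rewrite mxE lnorm_proj.
Qed.

(** The exponent 0 belongs to [is_nneg] and not to [is_neg], so these two are complementary;
    [is_npos] meets [is_nneg] at 0 and describes [W_-]. *)
Definition is_nneg : pred int := fun k => 0 <= k.
Definition is_npos : pred int := fun k => k <= 0.
Definition is_neg : pred int := fun k => k < 0.

Lemma is_nnegD k l : is_nneg k -> is_nneg l -> is_nneg (k + l).
Proof. exact: addr_ge0. Qed.

Lemma is_nposD k l : is_npos k -> is_npos l -> is_npos (k + l).
Proof. by rewrite /is_npos; lia. Qed.

Definition right_op (X A : 'M[l1 R]_n) := map_mx (proj is_nneg) (X *m A).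
Definition left_op (X A : 'M[l1 R]_n) := map_mx (proj is_neg) (A *m X).

Fact right_op_additive X : zmod_morphism (right_op X).
Proof. by move=> A B; rewrite /right_op mulmxBr map_mxB. Qed.

Fact left_op_additive X : zmod_morphism (left_op X).
Proof. by move=> A B; rewrite /left_op mulmxBl map_mxB. Qed.

HB.instance Definition _ X :=
  GRing.isZmodMorphism.Build _ _ (right_op X) (right_op_additive X).
HB.instance Definition _ X :=
  GRing.isZmodMorphism.Build _ _ (left_op X) (left_op_additive X).

Lemma canonical_factorisation (X : 'M[l1 R]_n) : mnorm X < 1 ->
  exists U V T Y : 'M[l1 R]_n,
    [/\ msupp is_neg (U - 1%:M) /\ msupp is_neg (V - 1%:M),
        msupp is_nneg T /\ msupp is_nneg Y,
        U *m V = 1%:M, T *m Y = 1%:M & U *m T = 1%:M + X].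
Proof.
move=> X1; have X0 := mnorm_ge0 X.
have [|Y hY] := @neumann R n (right_op X) (mnorm X) X0 X1.
  by move=> A; rewrite (le_trans (mnorm_proj _ _))// mnormM.
have [|V hV] := @neumann R n (left_op X) (mnorm X) X0 X1.
  by move=> A; rewrite (le_trans (mnorm_proj _ _))// mulrC mnormM.
have EY : Y = 1%:M - right_op X Y by rewrite -hY addrK.
have EV : V = 1%:M - left_op X V by rewrite -hV addrK.
pose U := (1%:M + X) *m Y; pose T := V *m (1%:M + X).
have Ys : msupp is_nneg Y.
  rewrite EY; apply: msuppD; first exact: msupp1.
  by move=> i j k hk; rewrite !mxE lcoefN supp_proj ?oppr0.
have Vs : msupp is_neg (V - 1%:M).
  rewrite EV addrAC subrr add0r => i j k hk.
  by rewrite !mxE lcoefN supp_proj ?oppr0.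
have Us : msupp is_neg (U - 1%:M).
  (* As [Y + P_+(X Y) = 1], the matrix [U = Y + X Y] differs from 1 by what [P_+] removes from
     [X Y]. *)
  have -> : U - 1%:M = X *m Y - right_op X Y.
    by rewrite /U mulmxDl mul1mx {1}EY addrAC [1%:M + _]addrC addrK addrC.
  by move=> i j; rewrite !mxE; apply: supp_projC => k; rewrite /is_neg /is_nneg ltNge.
have Ts : msupp is_nneg T.
  have -> : T = 1%:M + (V *m X - left_op X V).
    by rewrite /T mulmxDr mulmx1 {1}EV addrAC -addrA.
  apply: msuppD; first exact: msupp1.
  by move=> i j; rewrite !mxE; apply: supp_projC => k; rewrite /is_neg /is_nneg leNgt.
have VUTY : V *m U = T *m Y by rewrite /U /T mulmxA.
have VUs : msupp is_neg (V *m U - 1%:M).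
  have -> : V *m U - 1%:M = (V - 1%:M) *m (U - 1%:M) + ((V - 1%:M) + (U - 1%:M)).
    rewrite mulmxBl mul1mx mulmxBr mulmx1.
    by rewrite [V - _ + _]addrC addrA subrK addrA subrK.
  apply: msuppD; last exact: msuppD.
  by apply: (msuppM _ Vs Us) => k l; rewrite /is_neg; lia.
have TYs : msupp is_nneg (T *m Y).
  exact: (msuppM is_nnegD Ts Ys).
(* A coefficient with [k < 0] vanishes both in [T Y] and in 1; one with [k >= 0] vanishes in
   [V U - 1], which is [T Y - 1]. *)
have TY1 : T *m Y = 1%:M.
  apply/eqP; rewrite -subr_eq0; apply/eqP/matrixP => i j; apply: l1_coefP => k.
  rewrite [in RHS]mxE lcoef0; have [k0|k0] := boolP (is_neg k); last first.
    by rewrite -VUTY VUs.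
  have pk : ~~ is_nneg k by rewrite /is_nneg -ltNge.
  rewrite mxE lcoefD TYs// add0r.
  rewrite mxE lcoefN; have -> : (1%:M : 'M[l1 R]_n) i j k = 0.
    by apply: (@msupp1 is_nneg).
  by rewrite oppr0.
(* One-sided inverses are two-sided over the commutative ring [l1]; the same fact cancels [Y T] in
   [U T = (1 + X) Y T]. *)
have UV1 : U *m V = 1%:M by apply: mulmx1C; rewrite VUTY.
exists U, V, T, Y; split => //.
by rewrite /U -mulmxA (mulmx1C TY1) mulmx1.
Qed.

End Supports.

(** * Compact circles and boundary values *)

Section ComplexTopology.
Variable R : realType.

Lemma ltr0c (k : R) : (0 < k%:C) = (0 < k).
Proof. exact: (ltcR 0 k). Qed.

Lemma nearCP (z : R[i]^o) (P : set R[i]^o) :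
  (\forall t \near z, P t) <->
  exists2 d : R, 0 < d & forall t : R[i], cmod (z - t) < d -> P t.
Proof.
split=> [/nbhs_ballP[e /= e0 h]|[d d0 h]]; last first.
  apply/nbhs_ballP; exists d%:C => /=; first by rewrite ltr0c.
  by move=> t; rewrite -ball_normE /= -cmodE ltcR; exact: h.
have er : e = (complex.Re e)%:C by rewrite RRe_real// gtr0_real.
exists (complex.Re e); first by rewrite -ltr0c -er.
by move=> t zt; apply: h; rewrite -ball_normE /= er -cmodE ltcR.
Qed.

Lemma cmod_dist (x y : R[i]) : `|cmod x - cmod y| <= cmod (x - y).
Proof.
rewrite ler_norml lerBrDl [_ - cmod (x - y)]addrC lerBlDr -{1}(cmodB y x).
have h1 := cmodD (y - x) x; have h2 := cmodD (x - y) y.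
by rewrite !subrK in h1 h2; rewrite (cmodB y x) in h1 *; apply/andP; split; lra.
Qed.

Lemma cmod_continuous : continuous (@cmod R : R[i]^o -> R).
Proof.
move=> z; apply/(@cvgrPdist_lt _ _ _ _ (nbhs_filter (z : R[i]^o))) => e e0.
apply/nearCP; exists e => // t zt.
exact: le_lt_trans (cmod_dist _ _) zt.
Qed.

Lemma Complex_continuous :
  continuous ((fun p => p.1 +i* p.2) : R * R -> R[i]^o).
Proof.
move=> [x y]; apply/cvgrPdist_lt => e e0.
have er : e = (complex.Re e)%:C by rewrite RRe_real// gtr0_real.
have e2 : 0 < complex.Re e / 2 by rewrite divr_gt0// -ltr0c -er.
have h : \forall p \near nbhs (x, y), `|x - p.1| < complex.Re e / 2 /\
                                  `|y - p.2| < complex.Re e / 2.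
  exists (ball x (complex.Re e / 2), ball y (complex.Re e / 2)).
    by split; exact: nbhsx_ballx.
  by move=> [a b] []; rewrite -!ball_normE.
near=> p; rewrite er -cmodE ltcR.
have [hx hy] : `|x - p.1| < complex.Re e / 2 /\ `|y - p.2| < complex.Re e / 2.
  by near: p.
apply: (le_lt_trans (cmod_le_ReIm _)) => /=; lra.
Unshelve. all: by end_near. Qed.

(** A closed subset of the compact square [[- zeta, zeta]^2], carried to [R[i]] by a continuous
    map. *)
Lemma circle_compact (zeta : R) : compact ([set t | cmod t = zeta] : set R[i]^o).
Proof.
pose S : set (R * R) := `[- zeta, zeta] `*` `[- zeta, zeta].
have cS : compact ((fun p => p.1 +i* p.2 : R[i]^o) @` S).
  apply: continuous_compact; first exact/continuous_subspaceT/Complex_continuous.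
  by apply: compact_setX; exact: segment_compact.
apply: (subclosed_compact _ cS).
  apply: (@preimage_closed _ _ (@cmod R : R[i]^o -> R) [set zeta]).
    by move=> t _; exact: cmod_continuous.
  exact: closed_eq.
move=> t /= tz; exists (complex.Re t, complex.Im t); last by case: t tz.
split; rewrite /= in_itv /= -ler_norml -tz; [exact: Re_le_cmod|exact: Im_le_cmod].
Qed.

Variables (f : R[i] -> R[i]) (D K : set R[i]) (zeta : R) (sg : R -> R).
Hypotheses (zeta0 : 0 < zeta) (sg1 : sg s @[s --> 1^'-] --> (1 : R)).
Hypotheses (DK : D `<=` K) (zK : forall t, cmod t = zeta -> K t)
  (zD : forall t, cmod t = zeta -> ~ D t)
  (sgD : forall s t, 0 < s < 1 -> cmod t = zeta -> D ((sg s)%:C * t)).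
Hypothesis (fext : extends_continuously f D K).

Let M := circle_max (extension f D) zeta.

Lemma near_left1 : \forall s \near (1 : R)^'-, 0 < s < 1.
Proof.
near=> s; apply/andP; split; last by near: s; exact: nbhs_left_lt.
by near: s; exact: nbhs_left_gt.
Unshelve. all: by end_near. Qed.

(** [sg s * t] lies in [D] and tends to [t] as [s] tends to 1 from below. For a disc [sg] will be
    the identity, for an exterior domain the inverse. *)
Lemma circle_adherent (t : R[i]^o) : cmod t = zeta -> closure (D : set R[i]^o) t.
Proof.
move=> tz B /nearCP[d d0 hB].
have [s [s1 sd]] : exists s, 0 < s < 1 /\ `|1 - sg s| < d / zeta.
  have h : \forall s \near (1 : R)^'-, `|1 - sg s| < d / zeta.
    by move/cvgrPdist_lt: sg1; apply; rewrite divr_gt0.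
  have : \forall s \near (1 : R)^'-, 0 < s < 1 /\ `|1 - sg s| < d / zeta.
    by apply: filterS2 near_left1 h.
  by move/(@filter_ex _ _ _) => [s hs]; exists s.
exists ((sg s)%:C * t); split; first exact: sgD.
apply: hB; rewrite -{1}[t]mul1r -mulrBl cmodM tz.
by rewrite -(rmorph1 (real_complex R)) -rmorphB cmod_real -ltr_pdivlMr.
Qed.

(** Adherence makes the filter of neighbourhoods within [D] proper, so the limit in [extension] is
    the value of any continuous extension. *)
Lemma extension_boundary (g : R[i]^o -> R[i]^o) (t : R[i]) :
  {within (K : set R[i]^o), continuous g} -> (forall t, D t -> g t = f t) ->
  cmod t = zeta -> extension f D t = g t.
Proof.
move=> /subspace_continuousP gc gf tz; rewrite /extension.
case: ifPn => [/[!inE] /(zD tz) //|_].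
have FF : ProperFilter (within (D : set R[i]^o) (nbhs (t : R[i]^o))).
  exact/within_nbhs_proper/circle_adherent.
apply: (@cvg_lim R[i]^o (@norm_hausdorff _ _) _ _ FF).
have := gc t (zK tz); apply: cvg_trans => A /= hA.
have /nearCP[d d0 h] : \forall s \near (t : R[i]^o), K s -> A (g s) by exact: hA.
suff : \forall s \near (t : R[i]^o), D s -> A (f s) by exact.
by apply/nearCP; exists d => // s /h hs Ds; rewrite -gf//; exact/hs/DK.
Qed.

(** [sup] is sure to dominate its set only when that set is bounded. Compactness makes the local
    bounds on [g] uniform, through the covering property with [B] tending to [+oo]. *)
Lemma boundary_bound :
  has_ubound [set cmod (extension f D t) | t in [set t | cmod t = zeta]].
Proof.
have [g [gc gf]] := fext.
have /compact_near_coveringP := @circle_compact zeta.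
move=> /(_ R +oo (fun B t => K t -> cmod (g t) <= B) _) [].
  move=> t tz; have := zK tz.
  move/subspace_continuousP: (gc) => /(_ t (zK tz)).
  move/cvgrPdist_lt => /(_ 1 ltr01) /nearCP[d d0 hd] Kt.
  exists ([set t' | cmod (t - t') < d], [set B | cmod (g t) + 1 <= B]).
    split; first by apply/nearCP; exists d.
    by apply: nbhs_pinfty_ge; rewrite num_real.
  move=> [t' B] /= [td hB] Kt'; apply: le_trans hB.
  have := hd _ td Kt'; rewrite -cmodE -(rmorph1 (real_complex R)) ltcR => h.
  have := cmod_dist (g t) (g t'); rewrite ler_norml => /andP[]; lra.
(* Neighbourhoods of [+oo] are given by strict inequalities, hence [B0 + 1]. *)
move=> B0 [_ hB]; exists (B0 + 1) => _ [t tz <-].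
rewrite (extension_boundary gc gf tz); apply: hB => //=; last exact: zK.
by rewrite ltrDl.
Qed.

Lemma cmod_extension_le t : cmod t = zeta -> cmod (extension f D t) <= M.
Proof. by move=> tz; apply: (ub_le_sup boundary_bound); exists t. Qed.

(** Uniform continuity of [g] along the compact circle: one [s] close to 1 serves all points [t] at
    once. *)
Lemma boundary_near (e : R) : 0 < e ->
  \forall s \near (1 : R)^'-, forall t, cmod t = zeta ->
    cmod (f ((sg s)%:C * t)) <= M + e.
Proof.
move=> e0; have [g [gc gf]] := fext.
have e2 : 0 < e / 2 by rewrite divr_gt0.
have /compact_near_coveringP := @circle_compact zeta.
move=> /(_ R (1 : R)^'- (fun s t => 0 < s < 1 -> cmod t = zeta ->
  cmod (g t - g ((sg s)%:C * t)) <= e) _) h.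
have {h} : \forall s \near (1 : R)^'-, forall t, cmod t = zeta -> 0 < s < 1 ->
  cmod t = zeta -> cmod (g t - g ((sg s)%:C * t)) <= e.
  apply: h => t tz; move/subspace_continuousP: (gc) => /(_ t (zK tz)).
  have e2C : 0 < (e / 2)%:C by rewrite ltr0c.
  move/cvgrPdist_lt => /(_ _ e2C) /nearCP[d d0 hd].
  have d2 : 0 < d / 2 by rewrite divr_gt0.
  have hs : \forall s \near (1 : R)^'-, `|1 - sg s| < d / 2 / zeta.
    by move/cvgrPdist_lt: sg1; apply; rewrite divr_gt0.
  exists ([set t' | cmod (t - t') < d / 2], [set s | `|1 - sg s| < d / 2 / zeta]).
    by split => //; apply/nearCP; exists (d / 2).
  move=> [t' s] /= [td sd] s1 tz'.
  have h1 : cmod (g t - g t') < e / 2.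
    rewrite -ltcR cmodE; apply: hd; last exact: zK.
    by rewrite (lt_trans td)//; lra.
  have hst : cmod (t' - (sg s)%:C * t') < d / 2.
    rewrite -{1}[t']mul1r -mulrBl cmodM tz'.
    by rewrite -(rmorph1 (real_complex R)) -rmorphB cmod_real -ltr_pdivlMr.
  have h2 : cmod (g t - g ((sg s)%:C * t')) < e / 2.
    rewrite -ltcR cmodE; apply: hd; last exact/DK/sgD.
    have := cmodD (t - t') (t' - (sg s)%:C * t').
    by rewrite addrA subrK; lra.
  have := cmodD (g t' - g t) (g t - g ((sg s)%:C * t')).
  by rewrite addrA subrK (cmodB (g t') (g t)); lra.
move=> h; apply: filterS2 near_left1 h => s s1 h t tz.
rewrite -gf; last exact: sgD.
have := h t tz s1 tz; have := cmod_extension_le tz.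
rewrite (extension_boundary gc gf tz) => h1 h2.
have := cmod_dist (g t) (g ((sg s)%:C * t)).
by rewrite ler_norml => /andP[]; lra.
Qed.

(** On the displaced circle a Cauchy estimate carries the factor [s ^+ k], which tends to 1 with
    [s]. *)
Lemma boundary_coef (A : R) (k : nat) :
  (forall s B, 0 < s < 1 ->
    (forall t, cmod t = zeta -> cmod (f ((sg s)%:C * t)) <= B) -> A * s ^+ k <= B) ->
  A <= M.
Proof.
move=> hA; apply/ler_addgt0Pr => e e0.
have cv : A * s ^+ k @[s --> (1 : R)^'-] --> A * 1 ^+ k.
  apply: cvg_at_left_filter; apply: cvgM; first exact: cvg_cst.
  exact: exprn_continuous.
rewrite expr1n mulr1 in cv; apply: (cvgr_to_le cv).
apply: filterS2 near_left1 (boundary_near e0) => s s1 h; exact: hA.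
Qed.

End ComplexTopology.

(** * Power series in [t] and in [t^-1] on circles *)

Section SeriesOnCircles.
Variable R : realType.
Implicit Types c : int -> R[i].

Lemma cvg_series_terms_bounded (a : nat -> R[i]) :
  cvgn (series (a : nat -> R[i]^o)) ->
  exists2 B : R, 0 <= B & forall k, cmod (a k) <= B.
Proof.
move=> /cvg_series_cvg_0 /cvgrPdist_lt /(_ 1 ltr01)[n _ hn].
exists (1 + \sum_(k < n) cmod (a k)).
  by rewrite addr_ge0// sumr_ge0// => k _; exact: cmod_ge0.
move=> k; have [nk|kn] := leqP n k.
  have := hn k nk; rewrite /= sub0r normrN -cmodE -(rmorph1 (real_complex R)) ltcR.
  move=> /ltW /le_trans -> //; rewrite lerDl sumr_ge0// => j _; exact: cmod_ge0.
rewrite (bigD1 (Ordinal kn))//= addrCA lerDl addr_ge0// sumr_ge0// => j _.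
exact: cmod_ge0.
Qed.

Lemma csum_int (f : int -> R[i]) : csummable f ->
  csum f = csum (fun n : nat => f n%:Z) + csum (fun n : nat => f (- n.+1%:Z)).
Proof.
move=> ff.
have pf (S : pred int) : csummable (fun k => if S k then f k else 0).
  by apply: csummable_le ff => k; case: ifP; rewrite ?cmod0 ?cmod_ge0.
transitivity (csum (fun k => (if is_nneg k then f k else 0) +
                             (if is_neg k then f k else 0))).
  congr csum; apply/funext => k; rewrite /is_nneg /is_neg ltNge.
  by case: ifP; rewrite ?addr0 ?add0r.
rewrite csumD//; congr (_ + _).
  rewrite (@csum_inj _ _ _ Posz); first by [].
    by move=> m n [].
  move=> [] m h; last by [].
  by case: (h m).
rewrite (@csum_inj _ _ _ (fun n : nat => - n.+1%:Z)); first by [].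
  by move=> m n [].
move=> [] m h; first by [].
by case: (h m); rewrite NegzE.
Qed.

Lemma plus_fun_csum c t : csummable (plus_terms c t) ->
  plus_fun c t = csum (plus_terms c t).
Proof. exact: csum_lim. Qed.

Lemma minus_fun_csum c t : csummable (minus_terms c t) ->
  minus_fun c t = csum (minus_terms c t).
Proof. exact: csum_lim. Qed.

Lemma csummable_comp (T U : choiceType) (e : U -> T) (f : T -> R[i]) :
  injective e -> csummable f -> csummable (fun i => f (e i)).
Proof.
move=> inje ff; rewrite /csummable /nfin.
rewrite (_ : (\esum_(i in _) _)%E =
  (\esum_(k in [set: T]) (cmod (if `[< exists i, k = e i >] then f k else 0))%:E)%E).
  apply: le_lt_trans ff; apply: le_esum => k _; rewrite lee_fin.
  by case: ifP; rewrite ?cmod0 ?cmod_ge0.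
rewrite [RHS](esum_injP inje); last first.
  by move=> k h; case: asboolP => [[i ki]|_]; [case: (h i)|rewrite cmod0].
by apply: eq_esum => i _; case: asboolP => // -[]; exists i.
Qed.

Lemma ev_plus_minus (x : l1 R) t : cmod t = 1 ->
  ev x t = plus_fun x t + minus_fun x t.
Proof.
move=> t1; have xf := csummable_ev t1 (lcoefP x).
rewrite /ev csum_int// plus_fun_csum ?minus_fun_csum//.
  by apply: (csummable_comp (e := fun n : nat => - n.+1%:Z) _ xf) => m n [].
by apply: (csummable_comp (e := Posz) _ xf) => m n [].
Qed.

Lemma eq_plus_fun c c' t : (forall n : nat, c n%:Z = c' n%:Z) ->
  plus_fun c t = plus_fun c' t.
Proof.
move=> h; rewrite /plus_fun (_ : plus_terms c t = plus_terms c' t)//.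
by apply/funext => n; rewrite /plus_terms h.
Qed.

Lemma eq_minus_fun c c' t : (forall n : nat, c (- n.+1%:Z) = c' (- n.+1%:Z)) ->
  minus_fun c t = minus_fun c' t.
Proof.
move=> h; rewrite /minus_fun (_ : minus_terms c t = minus_terms c' t)//.
by apply/funext => n; rewrite /minus_terms h.
Qed.

Lemma csummable0 (T : choiceType) : csummable (fun _ : T => 0 : R[i]).
Proof. by rewrite /csummable /nfin esum1 ?ltry// => k _; rewrite cmod0. Qed.

Lemma plus_fun0 c t : (forall n : nat, c n%:Z = 0) -> plus_fun c t = 0.
Proof.
move=> h; have h0 : plus_terms c t = (fun=> 0).
  by apply/funext => n; rewrite /plus_terms h mul0r.
by rewrite plus_fun_csum h0; [exact: csum0|exact: csummable0].
Qed.

Lemma minus_fun0 c t : (forall n : nat, c (- n.+1%:Z) = 0) -> minus_fun c t = 0.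
Proof.
move=> h; have h0 : minus_terms c t = (fun=> 0).
  by apply/funext => n; rewrite /minus_terms h mul0r.
by rewrite minus_fun_csum h0; [exact: csum0|exact: csummable0].
Qed.

(** [c] is arbitrary at the indices that [plus_fun] does not read; zeros there allow a family
    indexed by all of [int] to be summable. *)
Definition plus_part c (k : int) : R[i] := if 0 <= k then c k else 0.
Definition minus_part c (k : int) : R[i] := if k < 0 then c k else 0.

Lemma csummable_plus_part c : csummable (fun n : nat => c n%:Z) ->
  csummable (plus_part c).
Proof.
move=> cf; apply: (@csummable_inj _ _ _ Posz) => //; first by move=> m n [].
by move=> [] m h; [case: (h m)|].
Qed.

Lemma csummable_minus_part c : csummable (fun n : nat => c (- n.+1%:Z)) ->
  csummable (minus_part c).
Proof.
move=> cf; apply: (@csummable_inj _ _ _ (fun n : nat => - n.+1%:Z)) => //.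
  by move=> m n [].
by move=> [] m h; [|case: (h m); rewrite NegzE].
Qed.

Lemma ev_plus_part c t : cmod t = 1 -> csummable (fun n : nat => c n%:Z) ->
  ev (plus_part c) t = plus_fun c t.
Proof.
move=> t1 /csummable_plus_part cf; rewrite (ev_plus_minus (L1 cf) t1)/=.
by rewrite [X in _ + X]minus_fun0// addr0; exact: eq_plus_fun.
Qed.

Lemma ev_minus_part c t : cmod t = 1 -> csummable (fun n : nat => c (- n.+1%:Z)) ->
  ev (minus_part c) t = minus_fun c t.
Proof.
move=> t1 /csummable_minus_part cf; rewrite (ev_plus_minus (L1 cf) t1)/=.
by rewrite [X in X + _]plus_fun0// add0r; exact: eq_minus_fun.
Qed.

(** Moves the circle of radius [zeta] to the unit circle, where [coef_le] gives the Cauchy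
    estimates. *)
Definition scaled c (zeta : R) (k : int) : R[i] := c k * zeta%:C ^ k.

Lemma plus_fun_scaled c (zeta : R) t :
  plus_fun (scaled c zeta) t = plus_fun c (zeta%:C * t).
Proof.
rewrite /plus_fun (_ : plus_terms (scaled c zeta) t = plus_terms c (zeta%:C * t))//.
by apply/funext => n; rewrite /plus_terms /scaled -mulrA expfzMl.
Qed.

Lemma minus_fun_scaled c (zeta : R) t :
  minus_fun (scaled c zeta) t = minus_fun c (zeta%:C * t).
Proof.
rewrite /minus_fun (_ : minus_terms (scaled c zeta) t = minus_terms c (zeta%:C * t))//.
by apply/funext => n; rewrite /minus_terms /scaled -mulrA expfzMl.
Qed.

Lemma cmod_scaled c (zeta : R) k : 0 <= zeta ->
  cmod (scaled c zeta k) = cmod (c k) * zeta ^ k.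
Proof. by move=> z0; rewrite cmodM cmodXz cmod_real ger0_norm. Qed.

Lemma cauchy_plus c (zeta M : R) (k : nat) : 0 <= zeta ->
  csummable (fun n : nat => scaled c zeta n%:Z) ->
  (forall t, cmod t = 1 -> cmod (plus_fun c (zeta%:C * t)) <= M) ->
  cmod (c k%:Z) * zeta ^+ k <= M.
Proof.
move=> z0 cf hM; have := @coef_le R _ M k%:Z (csummable_plus_part cf).
rewrite /plus_part /= cmod_scaled//; apply.
by move=> t t1; rewrite ev_plus_part// plus_fun_scaled hM.
Qed.

Lemma cauchy_minus c (zeta M : R) (k : nat) : 0 <= zeta ->
  csummable (fun n : nat => scaled c zeta (- n.+1%:Z)) ->
  (forall t, cmod t = 1 -> cmod (minus_fun c (zeta%:C * t)) <= M) ->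
  cmod (c (- k.+1%:Z)) * zeta ^- k.+1 <= M.
Proof.
move=> z0 cf hM; have := @coef_le R _ M (- k.+1%:Z) (csummable_minus_part cf).
rewrite /minus_part /= cmod_scaled//; apply.
by move=> t t1; rewrite ev_minus_part// minus_fun_scaled hM.
Qed.

(** Abel's argument: convergence at a radius [r] strictly between [zeta] and [r2] bounds the terms
    there, and the ratio [zeta / r] gives a geometric majorant. *)
Lemma summable_plus (r2 : \bar R) c (zeta : R) : analytic_plus r2 c ->
  0 <= zeta -> (zeta%:E < r2)%E -> csummable (fun n : nat => scaled c zeta n%:Z).
Proof.
move=> ca z0 zr.
have [r zr' rr2] : exists2 r : R, zeta < r & (r%:E < r2)%E.
  case: r2 zr {ca} => [r2||//]; last first.
    by move=> _; exists (zeta + 1); rewrite ?ltry// ltrDl.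
  by rewrite lte_fin => h; exists ((zeta + r2) / 2); rewrite ?lte_fin; lra.
have r0 : 0 < r by exact: le_lt_trans zr'.
have cr : cmod (r%:C) = r by rewrite cmod_real gtr0_norm.
have [B B0 hB] : exists2 B : R, 0 <= B & forall k, cmod (plus_terms c r%:C k) <= B.
  by apply: cvg_series_terms_bounded; apply: ca; rewrite /disc /= cr.
have q0 : 0 <= zeta / r by rewrite divr_ge0// ltW.
have q1 : zeta / r < 1 by rewrite ltr_pdivrMr// mul1r.
have hg k : cmod (scaled c zeta k%:Z) <= B * (zeta / r) ^+ k.
  rewrite cmod_scaled// -[_ ^ _]/(zeta ^+ k) expr_div_n mulrA mulrAC.
  rewrite ler_wpM2r ?exprn_ge0//.
  rewrite ler_pdivlMr ?exprn_gt0//.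
  by have := hB k; rewrite cmodM cmodXz cr.
apply: (nfin_bound (M := B / (1 - zeta / r))).
by apply: esum_geometric => // k; exact: cmod_ge0.
Qed.

Lemma summable_minus (r1 : R) c (zeta : R) : analytic_minus r1 c ->
  0 <= r1 -> r1 < zeta -> csummable (fun n : nat => scaled c zeta (- n.+1%:Z)).
Proof.
move=> ca r10 rz; pose r := (r1 + zeta) / 2.
have r1r : r1 < r by rewrite /r; lra.
have rz' : r < zeta by rewrite /r; lra.
have r0 : 0 < r by exact: le_lt_trans r1r.
have z0 : 0 < zeta by exact: lt_trans rz'.
have cr : cmod (r%:C) = r by rewrite cmod_real gtr0_norm.
have [B B0 hB] : exists2 B : R, 0 <= B & forall k, cmod (minus_terms c r%:C k) <= B.
  by apply: cvg_series_terms_bounded; apply: ca; rewrite /exterior /= cr.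
have q0 : 0 <= r / zeta by rewrite divr_ge0// ltW.
have q1 : r / zeta < 1 by rewrite ltr_pdivrMr// mul1r.
have hg k : cmod (scaled c zeta (- k.+1%:Z)) <= B * (r / zeta) ^+ k.
  (* The exponent is [k.+1] because the series starts at [t^-1]; the extra factor below 1 is
     discarded. *)
  apply: (@le_trans _ _ (B * (r / zeta) ^+ k.+1)); last first.
    by rewrite ler_wpM2l// exprS ler_piMl ?exprn_ge0// ltW.
  rewrite cmod_scaled ?(ltW z0)// -[_ ^ _]/(zeta ^- k.+1) expr_div_n mulrA.
  rewrite ler_wpM2r ?invr_ge0 ?exprn_ge0 ?(ltW z0)//.
  rewrite -ler_pdivrMr ?exprn_gt0//.
  by have := hB k; rewrite cmodM cmodXz cr.
apply: (nfin_bound (M := B / (1 - r / zeta))).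
by apply: esum_geometric => // k; exact: cmod_ge0.
Qed.

End SeriesOnCircles.

(** * Cauchy estimates, up to the boundary radius *)

Section CauchyEstimates.
Variable R : realType.

Lemma scale_circle (zeta : R) (t : R[i]) : 0 < zeta -> cmod t = 1 ->
  cmod (zeta%:C * t) = zeta.
Proof. by move=> z0 t1; rewrite cmodM t1 mulr1 cmod_real gtr0_norm. Qed.

Lemma unscale_circle (zeta : R) (t : R[i]) : 0 < zeta -> cmod t = zeta ->
  exists2 w, cmod w = 1 & t = zeta%:C * w.
Proof.
move=> z0 tz; have zC : zeta%:C != 0 by rewrite -cmod_eq0 cmod_real normr_eq0 gt_eqF.
exists (t / zeta%:C); last by rewrite mulrC divfK.
by rewrite cmodM cmodV cmod_real gtr0_norm// tz divff// gt_eqF.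
Qed.

Lemma circle_max_le (f : R[i] -> R[i]) (zeta B : R) :
  (forall t, cmod t = zeta -> cmod (f t) <= B) ->
  forall t, cmod t = zeta -> cmod (f t) <= circle_max f zeta.
Proof.
move=> hB t tz; apply: ub_le_sup; last by exists t.
by exists B => _ [s sz <-]; exact: hB.
Qed.

Lemma extension_in (f : R[i] -> R[i]) (D : set R[i]) t : D t -> extension f D t = f t.
Proof. by move=> Dt; rewrite /extension mem_set. Qed.

(** For [zeta < r2] the circle lies in [disc r2], where [extension] is the function itself. At
    [zeta = r2] summability on the circle is not known, so the estimates at radius [s * zeta] are
    passed to the limit. *)
Lemma alpha_bound (r2 : \bar R) (alpha : int -> R[i]) (zeta : R) (k : nat) :
  analytic_plus r2 alpha -> 1 < zeta ->
  ((zeta%:E < r2)%E \/ zeta%:E = r2 /\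
   extends_continuously (plus_fun alpha) (disc r2) (closed_disc r2)) ->
  cmod (alpha k%:Z) * zeta ^+ k <= Mplus r2 alpha zeta.
Proof.
move=> aa z1; have z0 : 0 < zeta by exact: lt_trans z1.
case=> [zr|[zE ext]]; last subst r2.
  have af := summable_plus aa (ltW z0) zr.
  have inD t : cmod t = zeta -> disc r2 t by rewrite /disc /= => ->.
  apply: cauchy_plus => //; first exact: ltW.
  move=> t t1; rewrite -(extension_in _ (inD _ (scale_circle z0 t1))).
  (* Any upper bound makes the supremum effective; the sum of the moduli provides one. *)
  apply: (circle_max_le (B := nsum (fun n : nat => cmod (scaled alpha zeta n%:Z))));
    last exact: scale_circle.
  move=> _ /(unscale_circle z0)[w w1 ->].
  rewrite (extension_in _ (inD _ (scale_circle z0 w1))).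
  have wf : csummable (plus_terms (scaled alpha zeta) w).
    by apply: csummable_le af => n; rewrite cmodM cmod_unitXz// mulr1.
  rewrite -plus_fun_scaled plus_fun_csum//; apply: le_trans (csum_norm wf) _.
  apply: le_nsum => [n|n|]; [exact: cmod_ge0| |exact: af].
  by rewrite [leLHS]cmodM cmod_unitXz// mulr1.
have memD t : disc zeta%:E t = (cmod t < zeta) :> Prop by rewrite /disc /= lte_fin.
have memK t : closed_disc zeta%:E t = (cmod t <= zeta) :> Prop.
  by rewrite /closed_disc /= lee_fin.
apply: (@boundary_coef R (plus_fun alpha) (disc zeta%:E) (closed_disc zeta%:E)
  zeta id z0 _ _ _ _ _ ext _ k).
- exact: cvg_at_left_filter.
- by move=> t; rewrite memD memK; exact: ltW.
- by move=> t; rewrite memK => ->.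
- by move=> t; rewrite memD => ->; rewrite ltxx.
- move=> s t /andP[s0 s1] tz; rewrite memD cmodM cmod_real gtr0_norm// tz.
  by rewrite -ltr_pdivlMr// divff// gt_eqF.
move=> s B /andP[s0 s1] hB; rewrite -mulrA -exprMn [zeta * s]mulrC.
apply: cauchy_plus; first by rewrite mulr_ge0// ltW.
  apply: (summable_plus aa _ _) => //; first by rewrite mulr_ge0// ltW.
  by rewrite lte_fin -ltr_pdivlMr// divff// gt_eqF.
by move=> t t1; rewrite rmorphM/= -mulrA; apply: hB; exact: scale_circle.
Qed.

Lemma beta_bound (r1 : R) (beta : int -> R[i]) (zeta : R) (k : nat) :
  analytic_minus r1 beta -> 0 <= r1 ->
  (r1 < zeta \/ [/\ zeta = r1, 0 < r1 &
   extends_continuously (minus_fun beta) (exterior r1) (closed_exterior r1)]) ->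
  cmod (beta (- k.+1%:Z)) * zeta ^- k.+1 <= Mminus r1 beta zeta.
Proof.
move=> ba r10; case=> [rz|[-> {}r10 ext]].
  have z0 : 0 < zeta by exact: le_lt_trans rz.
  have bf := summable_minus ba r10 rz.
  have inD t : cmod t = zeta -> exterior r1 t by rewrite /exterior /= => ->.
  apply: cauchy_minus => //; first exact: ltW.
  move=> t t1; rewrite -(extension_in _ (inD _ (scale_circle z0 t1))).
  apply: (circle_max_le (B := nsum (fun n : nat => cmod (scaled beta zeta (- n.+1%:Z)))));
    last exact: scale_circle.
  move=> _ /(unscale_circle z0)[w w1 ->].
  rewrite (extension_in _ (inD _ (scale_circle z0 w1))).
  have wf : csummable (minus_terms (scaled beta zeta) w).
    by apply: csummable_le bf => n; rewrite cmodM cmod_unitXz// mulr1.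
  rewrite -minus_fun_scaled minus_fun_csum//; apply: le_trans (csum_norm wf) _.
  apply: le_nsum => [n|n|]; [exact: cmod_ge0| |exact: bf].
  by rewrite [leLHS]cmodM cmod_unitXz// mulr1.
have sV (s : R) : 0 < s < 1 -> r1 < s^-1 * r1.
  by move=> /andP[s0 s1]; rewrite -ltr_pdivrMr// divff ?gt_eqF// invf_gt1.
apply: (@boundary_coef R (minus_fun beta) (exterior r1) (closed_exterior r1)
  r1 GRing.inv r10 _ _ _ _ _ ext _ k.+1).
- rewrite -[X in _ --> X]invr1; apply: cvg_at_left_filter.
  by apply: cvgV; [rewrite oner_eq0|exact: cvg_id].
- by move=> t; exact: ltW.
- by move=> t; rewrite /closed_exterior /= => ->.
- by move=> t; rewrite /exterior /= => ->; rewrite ltxx.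
- move=> s t s01 tz; rewrite /exterior /= cmodM cmod_real tz gtr0_norm ?sV//.
  by rewrite invr_gt0; case/andP: s01.
move=> s B s01 hB; have /andP[s0 s1] := s01.
(* The radius grows to [s^-1 * r1], so that negative powers again produce the factor [s ^+ k.+1]. *)
have -> : cmod (beta (- k.+1%:Z)) * r1 ^- k.+1 * s ^+ k.+1 =
          cmod (beta (- k.+1%:Z)) * (s^-1 * r1) ^- k.+1.
  by rewrite exprMn invfM exprVn invrK -mulrA [s ^+ _ * _]mulrC.
apply: cauchy_minus; first by rewrite mulr_ge0 ?invr_ge0// ltW.
  by apply: (summable_minus ba); [exact: ltW|exact: sV].
by move=> t t1; rewrite rmorphM/= -mulrA; apply: hB; exact: scale_circle.
Qed.

End CauchyEstimates.

(** * Truncation errors in the Wiener norm *)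

Section Truncations.
Variable R : realType.

Lemma lnorm_geometric (x : l1 R) (e : nat -> int) (A q : R) : injective e ->
  (forall k, (forall n, k <> e n) -> x k = 0) -> 0 <= q -> q < 1 -> 0 <= A ->
  (forall n, cmod (x (e n)) <= A * q ^+ n) -> lnorm x <= A / (1 - q).
Proof.
move=> inje x0 q0 q1 A0 h; rewrite -lee_fin -lnormE (esum_injP inje); last first.
  by move=> k /x0 ->; rewrite cmod0.
by apply: esum_geometric => // n; exact: cmod_ge0.
Qed.

Lemma summable_alpha (r2 : \bar R) (alpha : int -> R[i]) :
  (1 < r2)%E -> analytic_plus r2 alpha -> csummable (plus_part alpha).
Proof.
move=> r21 aa; apply: csummable_plus_part.
apply: csummable_le (summable_plus aa ler01 r21) => n.
by rewrite cmod_scaled// exp1rz mulr1.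
Qed.

Lemma summable_beta (r1 : R) (beta : int -> R[i]) :
  0 <= r1 -> r1 < 1 -> analytic_minus r1 beta -> csummable (minus_part beta).
Proof.
move=> r10 r11 ba; apply: csummable_minus_part.
apply: csummable_le (summable_minus ba r10 r11) => n.
by rewrite cmod_scaled// exp1rz mulr1.
Qed.

Variables (alpha beta : int -> R[i]) (N : nat).
Hypotheses (af : csummable (plus_part alpha)) (bf : csummable (minus_part beta)).

Let a := L1 af.
Let b := L1 bf.
Let aN := proj (fun k => k <= N%:Z) a.
Let bN := proj (fun k => - N%:Z <= k) b.

Lemma lev_alpha t : cmod t = 1 -> lev t a = plus_fun alpha t.
Proof.
move=> t1; rewrite levE// ev_plus_minus// [X in _ + X]minus_fun0// addr0.
exact: eq_plus_fun.
Qed.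

Lemma lev_beta t : cmod t = 1 -> lev t b = minus_fun beta t.
Proof.
move=> t1; rewrite levE// ev_plus_minus// [X in X + _]plus_fun0// add0r.
exact: eq_minus_fun.
Qed.

Lemma csummable_partial (f : nat -> R[i]) n :
  csummable (fun k => if (k < n)%N then f k else 0).
Proof.
apply: (nfin_bound (M := \sum_(i < n) cmod (f i))).
rewrite -nneseries_esumT; last by move=> k; rewrite lee_fin cmod_ge0.
rewrite (nneseries_split_cond 0 n)//; last by move=> k _; rewrite lee_fin cmod_ge0.
rewrite add0n [X in (_ + X)%E]eseries0 ?adde0; last first.
  by move=> k nk _; rewrite ltnNge nk cmod0.
rewrite sumEFin lee_fin big_mkord; apply: ler_sum => i _.
by rewrite ltn_ord.
Qed.

Lemma lev_alphaN t : cmod t = 1 -> lev t aN = plus_trunc N alpha t.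
Proof.
move=> t1; rewrite levE// ev_plus_minus// [X in _ + X]minus_fun0 ?addr0; last first.
  by move=> n /=; rewrite ?if_same.
have E : plus_terms aN t =
    (fun k => if (k < N.+1)%N then alpha k%:Z * t ^ k%:Z else 0).
  apply/funext => k; rewrite /plus_terms /aN /= /plus_part lez_nat ltnS.
  by case: ifP; rewrite ?mul0r.
rewrite plus_fun_csum E; last exact: csummable_partial.
exact: (csum_partial (fun k : nat => alpha k%:Z * t ^ k%:Z)).
Qed.

Lemma lev_betaN t : cmod t = 1 -> lev t bN = minus_trunc N beta t.
Proof.
move=> t1; rewrite levE// ev_plus_minus// [X in X + _]plus_fun0 ?add0r; last first.
  by move=> n /=; rewrite ?if_same.
have E : minus_terms bN t =
    (fun k => if (k < N)%N then beta (- k.+1%:Z) * t ^ (- k.+1%:Z) else 0).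
  apply/funext => k; rewrite /minus_terms /bN; cbn [lcoef proj].
  (* Index [k] stands for the exponent [- k.+1], so the exponents from [- N] to -1 are exactly [N]
     terms. *)
  have -> : (- N%:Z <= - k.+1%:Z) = (k < N)%N by rewrite lerN2 lez_nat.
  by case: ifP; rewrite ?mul0r.
rewrite minus_fun_csum E; last exact: csummable_partial.
exact: (csum_partial (fun k : nat => beta (- k.+1%:Z) * t ^ (- k.+1%:Z))).
Qed.

Section AlphaNorms.
Variables (zeta M : R).
Hypotheses (z1 : 1 < zeta) (hM : forall k : nat, cmod (alpha k%:Z) * zeta ^+ k <= M).

Let z0 : 0 < zeta. Proof. exact: lt_trans z1. Qed.
Let q0 : 0 <= zeta^-1. Proof. by rewrite invr_ge0 ltW. Qed.
Let q1 : zeta^-1 < 1. Proof. by rewrite invf_lt1. Qed.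
Let M0 : 0 <= M.
Proof. by apply: le_trans (hM 0); rewrite mulr_ge0// cmod_ge0. Qed.

Let alpha_le (k : nat) : cmod (alpha k%:Z) <= M * zeta^-1 ^+ k.
Proof. by rewrite exprVn ler_pdivlMr ?exprn_gt0. Qed.

(** The geometric majorant with ratio [zeta^-1] sums to [M / (1 - zeta^-1)]. *)
Lemma lnorm_alpha : lnorm a <= zeta * M / (zeta - 1).
Proof.
have -> : zeta * M / (zeta - 1) = M / (1 - zeta^-1).
  by field; rewrite !gt_eqF ?subr_gt0 ?z0//; move: z1; lra.
apply: (lnorm_geometric (e := Posz)) => //; first by move=> m n [].
by move=> [] m h //; case: (h m).
Qed.

(** The first omitted index is [N.+1]; one power of [zeta] is absorbed by [1 - zeta^-1]. *)
Lemma lnorm_alphaB : lnorm (a - aN) <= M / (zeta ^+ N * (zeta - 1)).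
Proof.
have -> : M / (zeta ^+ N * (zeta - 1)) = M * zeta^-1 ^+ N.+1 / (1 - zeta^-1).
  have zN : zeta ^+ N != 0 by rewrite expf_neq0// gt_eqF.
  rewrite exprVn exprS; field.
  by rewrite zN !gt_eqF ?subr_gt0 ?z0//; move: z1; lra.
apply: (lnorm_geometric (e := fun m => (N.+1 + m)%N%:Z)) => //.
- by move=> m n [] /addnI.
- move=> k h; rewrite lcoefD lcoefN /= /plus_part.
  case: k h => m h /=; last by rewrite ?if_same subr0.
  rewrite lez_nat; case: leqP => [_|Nm]; first by rewrite subrr.
  by case: (h (m - N.+1)%N); rewrite subnKC.
- by rewrite mulr_ge0// exprn_ge0.
move=> n; rewrite lcoefD lcoefN /= /plus_part /= lez_nat.
by rewrite leqNgt addSn ltnS leq_addr /= subr0 -mulrA -exprD -addSn.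
Qed.

End AlphaNorms.

Section BetaNorms.
Variables (zeta M : R).
Hypotheses (z0 : 0 < zeta) (z1 : zeta < 1)
  (hM : forall k : nat, cmod (beta (- k.+1%:Z)) * zeta ^- k.+1 <= M).

Let q0 : 0 <= zeta. Proof. exact: ltW. Qed.
Let M0 : 0 <= M.
Proof. by apply: le_trans (hM 0); rewrite mulr_ge0 ?cmod_ge0// invr_ge0. Qed.

Let beta_le (k : nat) : cmod (beta (- k.+1%:Z)) <= M * zeta ^+ k.+1.
Proof. by rewrite -ler_pdivrMr ?exprn_gt0. Qed.

(** The series starts at exponent -1, whence the factor [zeta]. *)
Lemma lnorm_beta : lnorm b <= zeta * M / (1 - zeta).
Proof.
apply: (lnorm_geometric (e := fun n : nat => - n.+1%:Z)) => //.
- by move=> m n [].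
- by move=> [] m h //; case: (h m); rewrite NegzE.
- by rewrite mulr_ge0.
- by move=> n; rewrite mulrC mulrA -exprSr mulrC; exact: beta_le.
Qed.

Lemma lnorm_betaN : lnorm bN <= zeta * M / (1 - zeta).
Proof. exact: le_trans (lnorm_proj _ _) lnorm_beta. Qed.

Lemma lnorm_betaB : lnorm (b - bN) <= zeta ^+ N.+1 * M / (1 - zeta).
Proof.
apply: (lnorm_geometric (e := fun m => - (N + m).+1%:Z)) => //.
- by move=> m n [] /addnI.
- move=> k h; rewrite lcoefD lcoefN; cbn [lcoef proj b]; rewrite /minus_part.
  case: k h => m h /=; first by rewrite ?if_same subr0.
  rewrite NegzE in h *; rewrite lerN2 lez_nat; case: (leqP m.+1 N) => [_|Nm].
    by rewrite subrr.
  by case: (h (m - N)%N); rewrite subnKC.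
- by rewrite mulr_ge0// exprn_ge0.
move=> n; rewrite lcoefD lcoefN.
have -> : bN (- (N + n).+1%:Z) = 0.
  rewrite /bN; cbn [lcoef proj]; rewrite lerN2 lez_nat.
  by rewrite leqNgt ltnS leq_addr.
rewrite subr0 (le_trans (beta_le _))// -addSn exprD mulrA.
by rewrite [M * _]mulrC.
Qed.

End BetaNorms.

End Truncations.

(** * Passage between [wiener] and matrices over [l1] *)

Section WienerMatrices.
Variables (R : realType) (p : nat).

Lemma col_le_norm1 (A : 'M[R[i]]_p) j : \sum_(i < p) cmod (A i j) <= norm1 A.
Proof. exact: (le_bigmax _ (fun j => \sum_(i < p) cmod (A i j))). Qed.

Lemma norm1_ge0 (A : 'M[R[i]]_p) : 0 <= norm1 A.
Proof. exact: bigmax_ge_id. Qed.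

Lemma entry_le_norm1 (A : 'M[R[i]]_p) i j : cmod (A i j) <= norm1 A.
Proof.
apply: le_trans (col_le_norm1 A j); rewrite (bigD1 i)//= lerDl.
by apply: sumr_ge0 => k _; exact: cmod_ge0.
Qed.

Lemma wcoef_entry_summable (A : wiener R p) i j :
  csummable (fun k => wcoef A k i j).
Proof.
by apply: csummable_le (wcoef_summable A) => k; exact: entry_le_norm1.
Qed.

Definition l1mx (A : wiener R p) : 'M[l1 R]_p :=
  \matrix_(i, j) L1 (wcoef_entry_summable A i j).

Lemma wevalE (A : wiener R p) t : cmod t = 1 ->
  weval A t = map_mx (lev t) (l1mx A).
Proof.
by move=> t1; apply/matrixP => i j; rewrite !mxE levE// ev_plus_minus.
Qed.

(** A maximum over columns of sums over [k] is at most the sum over [k] of the maxima. *)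
Lemma mnorm_l1mx (A : wiener R p) : mnorm (l1mx A) <= wnorm A.
Proof.
apply: mnorm_le => [|j].
  by apply/fine_ge0/esum_ge0 => k _; rewrite lee_fin norm1_ge0.
have -> : wnorm A = nsum (fun k => norm1 (wcoef A k)) by [].
rewrite -lee_fin -nsumE; last exact: wcoef_summable.
  rewrite -sumEFin; under eq_bigr do rewrite -lnormE.
  rewrite -esum_sum; last by move=> k i _ _; rewrite lee_fin cmod_ge0.
  apply: le_esum => k _; rewrite sumEFin lee_fin.
  by under eq_bigr do rewrite mxE /=; exact: col_le_norm1.
by move=> k; exact: norm1_ge0.
Qed.

(** Finiteness is all that is claimed, so the column maximum is bounded crudely by the sum over all
    entries. *)
Lemma coef_norm_l1 (M : 'M[l1 R]_p) :
  (coef_norm (fun k => \matrix_(i, j) M i j k) < +oo)%E.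
Proof.
apply: (@le_lt_trans _ _ (\sum_(j < p) \sum_(i < p) (lnorm (M i j))%:E)%E).
  apply: (@le_trans _ _ (\esum_(k in [set: int])
      (\sum_(j < p) \sum_(i < p) (cmod (M i j k))%:E))%E).
    apply: le_esum => k _; under eq_bigr do rewrite sumEFin.
    rewrite sumEFin lee_fin; apply: bigmax_le.
      by apply: sumr_ge0 => j _; apply: sumr_ge0 => i _; exact: cmod_ge0.
    move=> j _; rewrite [leRHS](bigD1 j)//= -[leLHS]addr0 lerD//.
      by apply: ler_sum => i _; rewrite mxE.
    by apply: sumr_ge0 => l _; apply: sumr_ge0 => i _; exact: cmod_ge0.
  rewrite esum_sum; last first.
    by move=> k j _ _; apply: sume_ge0 => i _; rewrite lee_fin cmod_ge0.
  apply: lee_sum => j _.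
  rewrite esum_sum; last by move=> k i _ _; rewrite lee_fin cmod_ge0.
  by apply: lee_sum => i _; rewrite lnormE.
by under eq_bigr do rewrite sumEFin; rewrite sumEFin ltry.
Qed.

Definition wiener_of (M : 'M[l1 R]_p) : wiener R p := Wiener (coef_norm_l1 M).

Lemma weval_of (M : 'M[l1 R]_p) t : cmod t = 1 ->
  weval (wiener_of M) t = map_mx (lev t) M.
Proof.
move=> t1; rewrite wevalE//; congr map_mx; apply/matrixP => i j.
by rewrite mxE; apply: l1_coefP => k /=; rewrite mxE.
Qed.

Lemma wminus_of (M : 'M[l1 R]_p) : msupp is_npos M -> wminus (wiener_of M).
Proof.
by move=> h k k0; apply/matrixP => i j; rewrite !mxE h// /is_npos -ltNge.
Qed.

Lemma wplus_of (M : 'M[l1 R]_p) : msupp is_nneg M -> wplus (wiener_of M).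
Proof.
by move=> h k k0; apply/matrixP => i j; rewrite !mxE h// /is_nneg -ltNge.
Qed.

Lemma msupp_wminus (A : wiener R p) : wminus A -> msupp is_npos (l1mx A).
Proof.
by move=> h i j k; rewrite /is_npos -ltNge mxE /= => /h ->; rewrite mxE.
Qed.

Lemma msupp_wplus (A : wiener R p) : wplus A -> msupp is_nneg (l1mx A).
Proof.
by move=> h i j k; rewrite /is_nneg -ltNge mxE /= => /h ->; rewrite mxE.
Qed.

End WienerMatrices.

(** * The diagonal factor and conjugation by it *)

Section DiagonalFactor.
Variables (R : realType) (rho1 rho2 : int).

Definition rho (i : 'I_2) : int := if i == 0 then rho1 else rho2.

Definition Dr : 'M[l1 R]_2 := diag_mx (\row_i lmono (rho i) 1).
Definition Drinv : 'M[l1 R]_2 := diag_mx (\row_i lmono (- rho i) 1).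

Lemma lev_Dr t : cmod t = 1 -> map_mx (lev t) Dr = dr rho1 rho2 t.
Proof.
move=> t1; apply/matrixP => i j; rewrite !mxE rmorphMn/= lev_mono// mul1r /rho.
by case: i j => [[|[|i]] hi] [[|[|j]] hj].
Qed.

Lemma Dr_Drinv : Dr *m Drinv = 1%:M.
Proof.
apply/matrixP => i j; rewrite mul_diag_mx !mxE.
have [->|ij] := eqVneq i j; last by rewrite mulr0n mulr0 mulr0n.
rewrite !mulr1n; apply: l1_levP => t t1.
rewrite rmorph1 rmorphM/= lev_mono// lev_mono// !mul1r -expfzDr ?subrr//.
exact: unit_neq0.
Qed.

(** Each column holds one monomial of norm 1. [sigma] can be 2 because [coef_norm] adds the
    contributions of different exponents. *)
Lemma mnorm_Drinv : mnorm Drinv <= 1.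
Proof.
apply: mnorm_le => // j; rewrite (bigD1 j)//= big1 => [|i ij].
  by rewrite !mxE eqxx mulr1n lnorm_mono cmod1 addr0.
by rewrite !mxE (negPf ij) mulr0n lnorm0.
Qed.

Lemma conj_Dr_npos (U : 'M[l1 R]_2) : rho1 <= rho2 -> rho2 - rho1 <= 1 ->
  msupp is_neg (U - 1%:M) -> msupp is_npos (Dr *m U *m Drinv).
Proof.
move=> r12 st hU.
(* Conjugation fixes the identity, so only [U - 1], supported on negative exponents, is
   displaced. *)
have -> : Dr *m U *m Drinv = Dr *m (U - 1%:M) *m Drinv + 1%:M.
  by rewrite mulmxBr mulmxBl mulmx1 Dr_Drinv subrK.
apply: msuppD; last exact: msupp1.
move=> i j; rewrite mul_mx_diag mul_diag_mx; move: (hU i j); rewrite !mxE.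
set x := (_ + _ : l1 R) => hx.
have h1 : supp [pred k | k < rho i] (lmono (rho i) 1 * x).
  apply: (suppM _ (supp_mono (S := pred1 (rho i)) 1 (eqxx _)) hx) => k l /eqP ->.
  by rewrite /is_neg /=; lia.
apply: (suppM _ h1 (supp_mono (S := pred1 (- rho j)) 1 (eqxx _))) => k l h /eqP ->.
(* [k < rho i] and [rho i - rho j <= 1] put the exponent [k - rho j] below 1. *)
by move: h; rewrite /is_npos /rho /=; case: (i == 0); case: (j == 0); lia.
Qed.

End DiagonalFactor.

(** * The difference between [a] and [a_N] *)

Section Perturbation.
Variables (R : realType) (alpha beta : int -> R[i]) (N : nat).
Hypotheses (af : csummable (plus_part alpha)) (bf : csummable (minus_part beta)).

Definition perturbation : 'M[l1 R]_2 :=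
  let a := L1 af in let b := L1 bf in
  let aN := proj (fun k => k <= N%:Z) a in
  let bN := proj (fun k => - N%:Z <= k) b in
  \matrix_(i, j) (if i == 0 then if j == 0 then 0 else b - bN
                  else if j == 0 then a - aN else a * b - aN * bN).

Lemma lev_perturbation (theta : int) t : cmod t = 1 ->
  matrix_a theta (plus_fun alpha) (minus_fun beta) t =
  matrix_a theta (plus_trunc N alpha) (minus_trunc N beta) t +
  map_mx (lev t) perturbation.
Proof.
move=> t1; apply/matrixP => i j; rewrite !mxE.
case: (i == 0); case: (j == 0);
  rewrite ?rmorph0 ?rmorphB ?rmorphM/= ?(lev_alpha, lev_beta, lev_alphaN, lev_betaN)//;
  ring.
Qed.

(** Let [Ca], [Cb] bound the norms of [a] and [bN], and [Da], [Db] those of [a - aN] and [b - bN].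
    The first column has norm at most [Da], the second at most [Db + Ca * Db + Da * Cb]; the
    right-hand side is the sum of these two bounds and so dominates both. *)
Lemma mnorm_perturbation (zeta1 zeta2 Mp Mm : R) : 0 < zeta1 -> zeta1 < 1 ->
  1 < zeta2 -> (forall k : nat, cmod (alpha k%:Z) * zeta2 ^+ k <= Mp) ->
  (forall k : nat, cmod (beta (- k.+1%:Z)) * zeta1 ^- k.+1 <= Mm) ->
  mnorm perturbation <=
  (1 + zeta2 * Mp / (zeta2 - 1)) * (zeta1 ^+ N.+1 * Mm / (1 - zeta1))
  + (1 + zeta1 * Mm / (1 - zeta1)) * (Mp / (zeta2 ^+ N * (zeta2 - 1))).
Proof.
move=> z10 z11 z21 hMp hMm.
have h1 := lnorm_alpha af z21 hMp.
have h2 := lnorm_alphaB N af z21 hMp.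
have h3 := lnorm_betaN N bf z10 z11 hMm.
have h4 := lnorm_betaB N bf z10 z11 hMm.
move: h1 h2 h3 h4; rewrite /perturbation.
set a := L1 af; set b := L1 bf; set aN := proj _ a; set bN := proj _ b.
set Ca := _ / (zeta2 - 1); set Da := Mp / _; set Cb := _ / (1 - zeta1).
set Db := _ * Mm / _ => h1 h2 h3 h4.
have a0 := lnorm_ge0 a; have da0 := lnorm_ge0 (a - aN).
have b0 := lnorm_ge0 bN; have db0 := lnorm_ge0 (b - bN).
have hab : lnorm (a * b - aN * bN) <= Ca * Db + Da * Cb.
  have -> : a * b - aN * bN = a * (b - bN) + (a - aN) * bN by ring.
  rewrite (le_trans (lnormD _ _))// lerD// (le_trans (lnormM _ _))//; exact: ler_pM.
have Ca0 : 0 <= Ca by exact: le_trans h1. have Da0 : 0 <= Da by exact: le_trans h2.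
have Cb0 : 0 <= Cb by exact: le_trans h3. have Db0 : 0 <= Db by exact: le_trans h4.
have P1 : 0 <= Ca * Db by exact: mulr_ge0.
have P2 : 0 <= Da * Cb by exact: mulr_ge0.
apply: mnorm_le; first by rewrite addr_ge0// mulr_ge0// addr_ge0.
move=> j; rewrite !big_ord_recl big_ord0 !mxE /=.
case: (j == 0);
  rewrite ?lnorm0 ?addr0 ?add0r mulrDl mul1r mulrDl mul1r [Cb * Da]mulrC; lra.
Qed.

End Perturbation.

(** * Factorisation of the full symbol *)

Unset Implicit Arguments.

Theorem theorem4p2 (R : realType) (theta : int) (r1 : R) (r2 : \bar R)
  (alpha beta : int -> R[i])
  (r1_ge0 : 0 <= r1) (r1_lt1 : r1 < 1) (r2_gt1 : (1 < r2)%E)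
  (alpha_analytic : analytic_plus r2 alpha)
  (beta_analytic : analytic_minus r1 beta)
  (N : nat) (zeta1 zeta2 : R)
  (zeta_admissible : admissible r1 r2 alpha beta zeta1 zeta2)
  (P : 'M[R[i]]_2) (hP : P = 1%:M \/ P = J2 R)
  (rho1 rho2 : int) (aNm aNp aNm_inv aNp_inv : wiener R 2)
  (aN_factorisation :
     wh_factorisation (matrix_a theta (plus_trunc N alpha) (minus_trunc N beta))
                      aNm rho1 rho2 aNp)
  (aN_stable : stable rho1 rho2)
  (aN_normalised : normalised P rho1 rho2 aNm)
  (aNm_invP : winverse aNm aNm_inv) (aNp_invP : winverse aNp aNp_inv)
  (q_lt1 : sigma R rho1 rho2 * delta r1 r2 alpha beta N zeta1 zeta2
           * wnorm aNp_inv * wnorm aNm_inv < 1) :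
  exists am ap : wiener R 2,
    wh_factorisation (matrix_a theta (plus_fun alpha) (minus_fun beta))
                     am rho1 rho2 ap
    /\ stable rho1 rho2.
Proof.
have af := summable_alpha r2_gt1 alpha_analytic.
have bf := summable_beta r1_ge0 r1_lt1 beta_analytic.
have [[mm [bm mbm mbmE]] [pp [bp pbp pbpE]] r12 aNE] := aN_factorisation.
have [[z10 z11] z1b] : (0 < zeta1 /\ zeta1 < 1) /\
   (r1 < zeta1 \/ [/\ zeta1 = r1, 0 < r1 &
    extends_continuously (minus_fun beta) (exterior r1) (closed_exterior r1)]).
  case: zeta_admissible => -[/andP[h1 h2] _|[-> h e] _]; last by split=> //; right.
  by split; [split=> //; exact: le_lt_trans h1|left].
have [z21 z2b] : 1 < zeta2 /\ ((zeta2%:E < r2)%E \/ zeta2%:E = r2 /\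
   extends_continuously (plus_fun alpha) (disc r2) (closed_disc r2)).
  case: zeta_admissible => _ [[h1 h2]|[h e]]; first by split=> //; left.
  by split; [rewrite -lte_fin h|right].
pose E := perturbation N af bf.
have Edelta : mnorm E <= delta r1 r2 alpha beta N zeta1 zeta2.
  apply: mnorm_perturbation => // k; first exact: alpha_bound.
  exact: beta_bound.
pose X := Drinv R rho1 rho2 *m l1mx aNm_inv *m E *m l1mx aNp_inv.
have X1 : mnorm X < 1.
  apply: le_lt_trans q_lt1; rewrite /X.
  have n0 := @mnorm_ge0 R 2; have hm := mnorm_l1mx aNm_inv; have hp := mnorm_l1mx aNp_inv.
  (* The bound 1 of [mnorm_Drinv] is relaxed to [sigma] to match the hypothesis. *)
  have s1 : 1 <= sigma R rho1 rho2 by rewrite sigmaE; case: ifP => // _; rewrite ler1n.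
  have wp := le_trans (n0 _) hp; have wm := le_trans (n0 _) hm.
  have d0 := le_trans (n0 _) Edelta.
  rewrite (le_trans (mnormM _ _))//.
  apply: (@le_trans _ _ (1 * wnorm aNm_inv *
      delta r1 r2 alpha beta N zeta1 zeta2 * wnorm aNp_inv)).
    rewrite ler_pM// (le_trans (mnormM _ _))// ler_pM// (le_trans (mnormM _ _))//.
    by rewrite ler_pM// mnorm_Drinv.
  rewrite [leRHS]mulrAC ler_wpM2r// [leRHS]mulrAC ler_wpM2r// ler_wpM2r//.
have [U [V [T [Y [[Us Vs] [Ts Ys] UV TY UT]]]]] := canonical_factorisation X1.
(* In [am * D * ap] the adjacent [Drinv] and [Dr] cancel, leaving [aNm * D * (U * T) * aNp] with
   [U * T = 1 + X]. *)
pose am := l1mx aNm *m (Dr R rho1 rho2 *m U *m Drinv R rho1 rho2).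
pose am' := (Dr R rho1 rho2 *m V *m Drinv R rho1 rho2) *m l1mx bm.
pose ap := T *m l1mx aNp.
pose ap' := l1mx bp *m Y.
have DD := Dr_Drinv R rho1 rho2; have DD' := mulmx1C DD.
(* [winverse] is an identity of functions on the circle; [l1_levP] lifts it to the ring, where
   inverses become two-sided. *)
have inv_l1 (A B : wiener R 2) : winverse A B -> l1mx A *m l1mx B = 1%:M.
  move=> AB; apply/matrixP => i j; apply: l1_levP => t t1.
  have := AB t t1; rewrite !wevalE// -map_mxM => /matrixP/(_ i j).
  by rewrite [in X in X -> _]mxE => ->; rewrite !mxE rmorph_nat.
have of_inv (A B : 'M[l1 R]_2) : A *m B = 1%:M -> winverse (wiener_of A) (wiener_of B).
  by move=> AB t t1; rewrite !weval_of// -map_mxM AB map_mx1.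
exists (wiener_of am), (wiener_of ap); split=> //; split=> //.
- split.
    apply/wminus_of/(msuppM is_nposD (msupp_wminus mm)).
    exact: conj_Dr_npos.
  exists (wiener_of am').
    (* [V - 1] has the same kind of support as [U - 1], so conjugation keeps the inverse of [am] in
       [W_-] as well. *)
    apply: wminus_of; apply: (msuppM is_nposD _ (msupp_wminus mbm)).
    exact: conj_Dr_npos.
  apply: of_inv; rewrite /am /am' -mulmxA [_ *m (_ *m l1mx bm)]mulmxA.
  have -> : Dr R rho1 rho2 *m U *m Drinv R rho1 rho2 *m
            (Dr R rho1 rho2 *m V *m Drinv R rho1 rho2) = 1%:M.
    rewrite !mulmxA -[_ *m Drinv _ _ _ *m Dr _ _ _]mulmxA DD' mulmx1.
    by rewrite -[_ *m U *m V]mulmxA UV mulmx1.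
  by rewrite mul1mx; exact: inv_l1.
- split; first exact/wplus_of/(msuppM is_nnegD Ts)/msupp_wplus.
  exists (wiener_of ap'); first exact/wplus_of/(msuppM is_nnegD (msupp_wplus pbp)).
  apply: of_inv; rewrite /ap /ap' -mulmxA [l1mx aNp *m _]mulmxA.
  by rewrite (inv_l1 _ _ pbpE) mul1mx.
move=> t t1; rewrite !weval_of// -(lev_Dr _ _ t1) -!map_mxM.
rewrite (lev_perturbation N af bf theta t1) aNE// !wevalE// -(lev_Dr _ _ t1).
rewrite -!map_mxM -map_mxD; congr map_mx.
have -> : am *m Dr R rho1 rho2 *m ap = l1mx aNm *m Dr R rho1 rho2 *m (U *m T) *m l1mx aNp.
  rewrite /am /ap !mulmxA.
  by rewrite -(mulmxA _ (Drinv _ _ _) (Dr _ _ _)) DD' mulmx1.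
rewrite UT mulmxDr mulmx1 mulmxDl /X; congr (_ + _).
rewrite !mulmxA -(mulmxA _ (Dr _ _ _) (Drinv _ _ _)) DD mulmx1.
(* [X] was chosen so that [aNm D X aNp] collapses to [E]; on the right the inverse stands before
   [aNp], hence [mulmx1C]. *)
rewrite (inv_l1 _ _ aNm_invP) mul1mx -(mulmxA E).
by rewrite (mulmx1C (inv_l1 _ _ aNp_invP)) mulmx1.
Qed.
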